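(* Assume $( * )$, i.e. work in ZF + DC + ''every subset of $2^{\omega}$ has the Baire property''. If $(G_n)_{n\in\omega}$ is a sequence of strongly bounded groups, then $\prod_{n\in\omega}G_n$ is also strongly bounded.
   Context: $( * )$ denotes the theory ZF + DC + ''every subset of the Cantor space $2^{\omega}=\{0,1\}^{\omega}$ (product topology) has the Baire property''; the full axiom of choice is not assumed. DC is the axiom of dependent choice: if $R$ is a binary relation on a nonempty set $X$ with $(\forall x)(\exists y)(xRy)$, then there is a sequence $(z_n)_{n\in\omega}$ with $z_nRz_{n+1}$ for all $n$. A subset $Y$ of a space $X$ has the Baire property if there is an open $U\subseteq X$ such that $Y\Delta U$ is meager in $X$. A group $G$ is strongly bounded if every action of $G$ by isometries on a metric space has bounded orbits. *)

(* Defs.v *)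
(** ZF is treated as a first-order theory: a theorem of ZF + DC + BP is a
    statement that holds in every structure (M, ∈) satisfying the axioms.  Every
    mathematical object below (function, group, metric space, ...) is an element
    of such a structure, and all quantifiers over objects range over M.  Assuming
    BP about Rocq's own predicates instead would make the theorem vacuous in the
    presence of a choice axiom for Rocq types. *)

Record structure := Structure {
  universe :> Type;
  mem : universe -> universe -> Prop
}.

Arguments mem {s} _ _.
Notation "x ∈ y" := (mem x y) (at level 70, no associativity).

(** First-order formulas of the language {∈, =}, with de Bruijn indices:
    under [f_all], index 0 is the bound variable. *)
Inductive formula : Type :=
| f_mem (i j : nat)
| f_eq (i j : nat)
| f_false
| f_imp (p q : formula)
| f_all (p : formula).

Definition scons {T : Type} (x : T) (e : nat -> T) (i : nat) : T :=
  match i with 0 => x | S j => e j end.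

Fixpoint sat {M : structure} (e : nat -> M) (p : formula) : Prop :=
  match p with
  | f_mem i j => e i ∈ e j
  | f_eq i j => e i = e j
  | f_false => False
  | f_imp q r => sat e q -> sat e r
  | f_all q => forall x : M, sat (scons x e) q
  end.

Section SetTheory.
Context {M : structure}.
Implicit Types a b c d e f g h m n p r s t u v w x y z : M.
Implicit Types A B C D F G I K L N P Q R S U W X Y Z : M.

Definition is_empty x : Prop := forall z, ~ z ∈ x.

Definition subset x y : Prop := forall z, z ∈ x -> z ∈ y.

Definition is_upair p x y : Prop := forall z, z ∈ p <-> z = x \/ z = y.

Definition is_union u x : Prop := forall z, z ∈ u <-> exists y, y ∈ x /\ z ∈ y.

Definition is_power p x : Prop := forall z, z ∈ p <-> subset z x.

Definition is_succ y x : Prop := forall z, z ∈ y <-> z ∈ x \/ z = x.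

Definition inductive x : Prop :=
  (exists e, is_empty e /\ e ∈ x) /\
  (forall y, y ∈ x -> exists z, is_succ z y /\ z ∈ x).

Record ZF : Prop := {
  ZF_extensionality : forall x y, (forall z, z ∈ x <-> z ∈ y) -> x = y;
  ZF_foundation : forall x, (exists y, y ∈ x) ->
    exists y, y ∈ x /\ forall z, z ∈ y -> ~ z ∈ x;
  ZF_pairing : forall x y, exists p, is_upair p x y;
  ZF_union : forall x, exists u, is_union u x;
  ZF_power : forall x, exists p, is_power p x;
  ZF_infinity : exists x, inductive x;
  ZF_separation : forall (p : formula) (e : nat -> M) x,
    exists y, forall z, z ∈ y <-> z ∈ x /\ sat (scons z e) p;
  ZF_replacement : forall (p : formula) (e : nat -> M) x,
    (forall y, y ∈ x -> exists! z, sat (scons z (scons y e)) p) ->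
    exists b, forall z,
      z ∈ b <-> exists y, y ∈ x /\ sat (scons z (scons y e)) p
}.

Definition is_omega x : Prop :=
  inductive x /\ forall y, inductive y -> subset x y.

(** Kuratowski pairs. *)
Definition is_pair p x y : Prop :=
  exists s t, is_upair s x x /\ is_upair t x y /\ is_upair p s t.

(** [rel f x y] says ⟨x, y⟩ ∈ f; for a function f it reads f(x) = y.
    [rel2 m x y z] reads m(x, y) = z. *)
Definition rel f x y : Prop := exists p, is_pair p x y /\ p ∈ f.

Definition rel2 m x y z : Prop := exists p, is_pair p x y /\ rel m p z.

Definition is_product Q A B : Prop :=
  forall p, p ∈ Q <-> exists x y, x ∈ A /\ y ∈ B /\ is_pair p x y.

Definition fun_on f A : Prop :=
  (forall p, p ∈ f -> exists x y, x ∈ A /\ is_pair p x y) /\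
  (forall x, x ∈ A -> exists! y, rel f x y).

Definition is_fun f A B : Prop :=
  fun_on f A /\ forall x y, rel f x y -> y ∈ B.

Definition is_fun2 m A B C : Prop :=
  exists Q, is_product Q A B /\ is_fun m Q C.

Definition relation_on R X : Prop :=
  forall p, p ∈ R -> exists x y, x ∈ X /\ y ∈ X /\ is_pair p x y.

Definition is_bijection f A B : Prop :=
  is_fun f A B /\ forall y, y ∈ B -> exists! x, rel f x y.

Section Omega.
Context (omega : M).

Definition finite F : Prop := exists n f, n ∈ omega /\ is_bijection f n F.

Definition DC : Prop :=
  forall X R,
    (exists x, x ∈ X) -> relation_on R X ->
    (forall x, x ∈ X -> exists y, y ∈ X /\ rel R x y) ->
    exists z, is_fun z omega X /\
      forall n n' x y,
        n ∈ omega -> is_succ n' n -> rel z n x -> rel z n' y -> rel R x y.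

Section Topology.
Context (X : M) (is_open : M -> Prop).

Definition adherent N x : Prop :=
  x ∈ X /\ forall U, is_open U -> x ∈ U -> exists y, y ∈ U /\ y ∈ N.

(** The closure of N has empty interior. *)
Definition nowhere_dense N : Prop :=
  subset N X /\
  ~ exists U, is_open U /\ (exists x, x ∈ U) /\ forall x, x ∈ U -> adherent N x.

Definition meager D : Prop :=
  exists N, fun_on N omega /\
    (forall n K, rel N n K -> nowhere_dense K) /\
    (forall x, x ∈ D <-> exists n K, rel N n K /\ x ∈ K).

Definition has_baire_property Y : Prop :=
  exists U D,
    is_open U /\
    (forall x, x ∈ D <-> (x ∈ Y /\ ~ x ∈ U) \/ (x ∈ U /\ ~ x ∈ Y)) /\
    meager D.

End Topology.

Definition is_two t : Prop :=
  forall x, x ∈ t <-> is_empty x \/ exists e, is_empty e /\ is_succ x e.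

Definition is_cantor C : Prop :=
  exists t, is_two t /\ forall x, x ∈ C <-> is_fun x omega t.

(** The product topology: a basic neighbourhood of x is given by fixing the
    coordinates in a finite F ⊆ ω. *)
Definition cantor_open C U : Prop :=
  subset U C /\
  forall x, x ∈ U ->
    exists F, subset F omega /\ finite F /\
      forall y, y ∈ C ->
        (forall n i, n ∈ F -> (rel x n i <-> rel y n i)) -> y ∈ U.

Definition BP : Prop :=
  forall C, is_cantor C ->
  forall Y, subset Y C -> has_baire_property C (cantor_open C) Y.

End Omega.

Definition assoc m : Prop :=
  forall x y z u v t,
    rel2 m x y u -> rel2 m u z t -> rel2 m y z v -> rel2 m x v t.

Definition comm m : Prop := forall x y z, rel2 m x y z -> rel2 m y x z.

Definition neutral A m e : Prop :=
  e ∈ A /\ forall x, x ∈ A -> rel2 m e x x /\ rel2 m x e x.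

Definition group A m : Prop :=
  is_fun2 m A A A /\ assoc m /\
  exists e, neutral A m e /\
    forall x, x ∈ A -> exists y, y ∈ A /\ rel2 m x y e /\ rel2 m y x e.

(** In ZF the real numbers are the complete ordered field, unique up to
    isomorphism. *)
Record field_data := FieldData { R_set : M; R_add : M; R_mul : M; R_le : M }.

Definition upper_bound (R : field_data) S b : Prop :=
  b ∈ R_set R /\ forall x, x ∈ S -> rel (R_le R) x b.

Record complete_ordered_field (R : field_data) : Prop := {
  cof_add_group : group (R_set R) (R_add R);
  cof_add_comm : comm (R_add R);
  cof_mul_fun : is_fun2 (R_mul R) (R_set R) (R_set R) (R_set R);
  cof_mul_assoc : assoc (R_mul R);
  cof_mul_comm : comm (R_mul R);
  cof_distr : forall x y z s p q t,
    rel2 (R_add R) y z s -> rel2 (R_mul R) x s t ->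
    rel2 (R_mul R) x y p -> rel2 (R_mul R) x z q -> rel2 (R_add R) p q t;
  cof_zero_one : exists o i,
    neutral (R_set R) (R_add R) o /\ neutral (R_set R) (R_mul R) i /\ o <> i /\
    forall x, x ∈ R_set R -> x <> o ->
      exists y, y ∈ R_set R /\ rel2 (R_mul R) x y i;
  cof_le_rel : relation_on (R_le R) (R_set R);
  cof_le_antisym : forall x y, rel (R_le R) x y -> rel (R_le R) y x -> x = y;
  cof_le_trans : forall x y z,
    rel (R_le R) x y -> rel (R_le R) y z -> rel (R_le R) x z;
  cof_le_total : forall x y, x ∈ R_set R -> y ∈ R_set R ->
    rel (R_le R) x y \/ rel (R_le R) y x;
  cof_le_add : forall x y z u v,
    rel (R_le R) x y -> rel2 (R_add R) x z u -> rel2 (R_add R) y z v ->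
    rel (R_le R) u v;
  cof_le_mul : forall o x y z, neutral (R_set R) (R_add R) o ->
    rel (R_le R) o x -> rel (R_le R) o y -> rel2 (R_mul R) x y z ->
    rel (R_le R) o z;
  cof_complete : forall S, subset S (R_set R) -> (exists x, x ∈ S) ->
    (exists b, upper_bound R S b) ->
    exists b, upper_bound R S b /\
      forall c, upper_bound R S c -> rel (R_le R) b c
}.

Section Metric.
Context (R : field_data).

Record metric_space (X d : M) : Prop := {
  dist_fun : is_fun2 d X X (R_set R);
  dist_ge0 : forall o x y r, neutral (R_set R) (R_add R) o ->
    rel2 d x y r -> rel (R_le R) o r;
  dist_eq0 : forall o x y r, neutral (R_set R) (R_add R) o ->
    rel2 d x y r -> (r = o <-> x = y);
  dist_sym : forall x y r, rel2 d x y r -> rel2 d y x r;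
  dist_triangle : forall x y z r s t u,
    rel2 d x y r -> rel2 d y z s -> rel2 d x z t -> rel2 (R_add R) r s u ->
    rel (R_le R) t u
}.

(** [rel2 a g x y] reads g · x = y. *)
Record isometric_action (G m X d a : M) : Prop := {
  act_fun : is_fun2 a G X X;
  act_one : forall e x, neutral G m e -> x ∈ X -> rel2 a e x x;
  act_mul : forall g h k x y z,
    rel2 m g h k -> rel2 a h x y -> rel2 a g y z -> rel2 a k x z;
  act_isometry : forall g x y x' y' r,
    rel2 a g x x' -> rel2 a g y y' -> rel2 d x y r -> rel2 d x' y' r
}.

Definition bounded_orbit G d a x : Prop :=
  exists b, b ∈ R_set R /\
    forall g h y z r, g ∈ G -> h ∈ G ->
      rel2 a g x y -> rel2 a h x z -> rel2 d y z r -> rel (R_le R) r b.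

Definition strongly_bounded G m : Prop :=
  group G m /\
  forall X d a, metric_space X d -> isometric_action G m X d a ->
  forall x, x ∈ X -> bounded_orbit G d a x.

End Metric.

(** A sequence of groups is given by two sequences of sets, A (the underlying
    sets) and L (the group laws); (P, m) is their full direct product. *)
Definition is_product_set omega A P : Prop :=
  forall f, f ∈ P <->
    fun_on f omega /\ forall n a x, rel A n a -> rel f n x -> x ∈ a.

Definition is_product_group omega A L P m : Prop :=
  is_product_set omega A P /\
  is_fun2 m P P P /\
  forall f g h, rel2 m f g h ->
    forall n l x y z, rel L n l ->
      rel f n x -> rel g n y -> rel h n z -> rel2 l x y z.

End SetTheory.

Arguments ZF : clear implicits.
Arguments field_data : clear implicits.

(* Main.v *)
(** Let the product P act isometrically on X, put len g := d(o, g·o), and suppose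
    that len is unbounded.  It is bounded on each factor, hence on the elements
    supported on finitely many coordinates, so it is unbounded on the elements
    trivial below any given n.  DC gives elements [s n], trivial below n, whose
    lengths grow geometrically.  For S ⊆ ω the ordered product [limit S] of the
    [s i], i ∈ S, converges coordinatewise, and if S and T differ exactly at j
    then [limit S] and [limit T] cannot both be short compared with [s j]:
    [limit S] is [limit T] multiplied by a conjugate of [s j] by a short element.

    Split ω into two infinite sets E and O and let Y be the set of the x in the
    Cantor space with len (limit (x ∩ E)) ≤ len (limit (x ∩ O)).  Switching one
    far digit of x, in E or in O, makes either side as large as desired, so Y
    and its complement both meet, by finite modifications of any given point,
    every neighbourhood of that point.  A point all of whose finite
    modifications avoid a given meager set shows that Y lacks the Baire property. *)

From Stdlib Require Import Classical ClassicalEpsilon FunctionalExtensionality PeanoNat.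
Require Import Defs.

(** * Definability *)

(* The obstacle on the formal side is that separation and replacement accept only first-order
   formulas with parameters, and DC only relations that are sets of the model. Every auxiliary set,
   function and induction predicate is therefore first shown definable. Rocq's [epsilon] serves only
   to name unique objects, with one fixed fallback value, so it brings no choice into the model.
   Choice inside the model is always DC: for the sequence [s], for the splitting of [omega], and for
   the category argument. The reason for two halves E and O: for a fixed bound b, the set of x with
   len (limit x) ≤ b could be left by switching a far digit, but nothing would bring a large length
   down again. Comparing two lengths removes this asymmetry. A digit of E changes the left side only
   and can lift it above the right side; a digit of O does the converse. *)
Existing Class ZF.

Section Definability.
Context {M : structure}.
Implicit Types (e : nat -> M) (P Q : (nat -> M) -> Prop) (s t u : (nat -> M) -> M).

Fixpoint ren (r : nat -> nat) (p : formula) : formula :=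
  match p with
  | f_mem i j => f_mem (r i) (r j)
  | f_eq i j => f_eq (r i) (r j)
  | f_false => f_false
  | f_imp p q => f_imp (ren r p) (ren r q)
  | f_all p => f_all (ren (scons 0 (fun i => S (r i))) p)
  end.

Lemma sat_ren p : forall r e, sat e (ren r p) <-> sat (fun i => e (r i)) p.
Proof.
  induction p as [i j|i j| |p IHp q IHq|p IHp]; intros r e; simpl; try tauto.
  - rewrite IHp, IHq; tauto.
  - assert (H : forall x, sat (scons x e) (ren (scons 0 (fun i => S (r i))) p)
                     <-> sat (scons x (fun i => e (r i))) p).
    { intros x. rewrite IHp.
      replace (fun i => scons x e (scons 0 (fun i0 => S (r i0)) i))
        with (scons x (fun i => e (r i))); [tauto|].
      extensionality i. now destruct i. }
    split; intros K x; apply H, K.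
Qed.

Definition look e (r : nat -> nat + M) (i : nat) : M :=
  match r i with inl j => e j | inr c => c end.

(** First-order definability with parameters: [r] sends each free variable of
    the formula to an environment slot or to a parameter.  Predicates and
    operations on the model are written as Rocq functions and shown definable
    by following their syntax (tactic [def] below), so no formula is written out. *)
Definition Def P : Prop := exists p r, forall e, P e <-> sat (look e r) p.

Lemma Def_ext P Q : (forall e, P e <-> Q e) -> Def P -> Def Q.
Proof.
  intros H [p [r K]]. exists p, r. intros e. rewrite <- H. apply K.
Qed.

Lemma Def_ren P (r : nat -> nat) : Def P -> Def (fun e => P (fun i => e (r i))).
Proof.
  intros [p [r' K]].
  exists p, (fun i => match r' i with inl j => inl (r j) | inr c => inr c end).
  intros e. rewrite K. unfold look.
  match goal with |- sat ?a _ <-> sat ?b _ => replace a with b; [tauto|] end.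
  extensionality i. unfold look. now destruct (r' i).
Qed.

(** Interleaving keeps the parameters of two formulas apart: the variables of the first move to even
    indices, those of the second to odd ones, and one assignment then serves both. *)
Definition mix {T : Type} (a b : nat -> T) (i : nat) : T :=
  if Nat.even i then a (Nat.div2 i) else b (Nat.div2 i).

Lemma mix_even {T : Type} (a b : nat -> T) i : mix a b (2 * i) = a i.
Proof.
  unfold mix. now rewrite Nat.even_even, Nat.div2_double.
Qed.

Lemma mix_odd {T : Type} (a b : nat -> T) i : mix a b (S (2 * i)) = b i.
Proof.
  unfold mix. rewrite <- Nat.add_1_r, Nat.even_odd, Nat.add_1_r.
  now rewrite Nat.div2_succ_double.
Qed.

Lemma Def_imp P Q : Def P -> Def Q -> Def (fun e => P e -> Q e).
Proof.
  intros [p [r K]] [q [r' K']].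
  exists (f_imp (ren (fun i => 2 * i) p) (ren (fun i => S (2 * i)) q)), (mix r r').
  intros e. cbn [sat]. rewrite !sat_ren, K, K'.
  match goal with |- (sat ?a _ -> sat ?b _) <-> (sat ?c _ -> sat ?d _) =>
    replace c with a; [replace d with b; [tauto|]|] end;
  extensionality i; unfold look; first [now rewrite mix_odd|now rewrite mix_even].
Qed.

Lemma Def_all (Q : M -> (nat -> M) -> Prop) :
  Def (fun e => Q (e 0) (fun i => e (S i))) -> Def (fun e => forall x, Q x e).
Proof.
  intros [p [r K]].
  (* Several variables of the formula may be sent to slot 0 by [r]; all of them become the bound
     index 0, and the others move up by one. Outside the quantifier every slot drops by one;
     [inl 0 => inl 0] is a dummy for variables that no longer occur. *)
  exists (f_all (ren (fun i => match r i with inl 0 => 0 | _ => S i end) p)),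
    (fun i => match r i with inl (S j) => inl j | inl 0 => inl 0 | inr c => inr c end).
  intros e. simpl sat.
  assert (H : forall x, Q x e <-> sat (scons x (look e (fun i => match r i with
       inl (S j) => inl j | inl 0 => inl 0 | inr c => inr c end)))
       (ren (fun i => match r i with inl 0 => 0 | _ => S i end) p)).
  { intros x. specialize (K (scons x e)). simpl in K.
    change (fun i => e i) with e in K. rewrite K, sat_ren.
    replace (look (scons x e) r) with
      (fun i => scons x (look e (fun i0 => match r i0 with
         inl (S j) => inl j | inl 0 => inl 0 | inr c => inr c end))
         (match r i with inl 0 => 0 | _ => S i end)); [tauto|].
    extensionality i. unfold look. destruct (r i) as [[|j]|c] eqn:E; simpl; now rewrite ?E. }
  split; intros K' x; apply H, K'.
Qed.

Lemma Def_False : Def (fun _ => False).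
Proof.
  exists f_false, (fun i => inl i). simpl. tauto.
Qed.

Lemma Def_True : Def (fun _ => True).
Proof.
  exists (f_imp f_false f_false), (fun i => inl i). simpl. tauto.
Qed.

Lemma Def_not P : Def P -> Def (fun e => ~ P e).
Proof.
  intros H. apply Def_imp; [exact H|exact Def_False].
Qed.

Lemma Def_and P Q : Def P -> Def Q -> Def (fun e => P e /\ Q e).
Proof.
  intros H K. apply Def_ext with (fun e => ~ (P e -> ~ Q e)).
  - intros e. tauto.
  - apply Def_not, Def_imp; [exact H|]. now apply Def_not.
Qed.

Lemma Def_or P Q : Def P -> Def Q -> Def (fun e => P e \/ Q e).
Proof.
  intros H K. apply Def_ext with (fun e => ~ P e -> Q e).
  - intros e. tauto.
  - apply Def_imp; [|exact K]. now apply Def_not.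
Qed.

Lemma Def_iff P Q : Def P -> Def Q -> Def (fun e => P e <-> Q e).
Proof.
  intros H K. apply Def_and; now apply Def_imp.
Qed.

Lemma Def_ex (Q : M -> (nat -> M) -> Prop) :
  Def (fun e => Q (e 0) (fun i => e (S i))) -> Def (fun e => exists x, Q x e).
Proof.
  intros H. apply Def_ext with (fun e => ~ forall x, ~ Q x e).
  - intros e. split; [apply not_all_not_ex|]. intros [x Hx] K. exact (K x Hx).
  - apply Def_not, Def_all, Def_not, H.
Qed.

Definition Trm t : Prop := Def (fun e => e 0 = t (fun i => e (S i))).

Lemma Trm_var n : Trm (fun e => e n).
Proof.
  exists (f_eq 0 1), (fun i => match i with 0 => inl 0 | _ => inl (S n) end).
  intros e. simpl. tauto.
Qed.

Lemma Trm_const c : Trm (fun _ => c).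
Proof.
  exists (f_eq 0 1), (fun i => match i with 0 => inl 0 | _ => inr c end).
  intros e. simpl. tauto.
Qed.

(** The language has no function symbols, so a definable term is substituted through an existential
    quantifier over its value. *)
Lemma Def_subst (Q : M -> (nat -> M) -> Prop) t :
  Def (fun e => Q (e 0) (fun i => e (S i))) -> Trm t -> Def (fun e => Q (t e) e).
Proof.
  intros H K. apply Def_ext with (fun e => exists x, x = t e /\ Q x e).
  - intros e. split; [now intros [x [-> Hx]]|]. intros Hx. now exists (t e).
  - apply Def_ex, Def_and; [exact K|exact H].
Qed.

Lemma Trm_ren (r : nat -> nat) t : Trm t -> Trm (fun e => t (fun i => e (r i))).
Proof.
  intros H. exact (Def_ren _ (scons 0 (fun i => S (r i))) H).
Qed.

Definition Def1 (P : M -> Prop) : Prop := Def (fun e => P (e 0)).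
Definition Def2 (P : M -> M -> Prop) : Prop := Def (fun e => P (e 0) (e 1)).
Definition Def3 (P : M -> M -> M -> Prop) : Prop := Def (fun e => P (e 0) (e 1) (e 2)).
Definition Def4 (P : M -> M -> M -> M -> Prop) : Prop :=
  Def (fun e => P (e 0) (e 1) (e 2) (e 3)).
Definition Trm1 (F : M -> M) : Prop := Trm (fun e => F (e 0)).
Definition Trm2 (F : M -> M -> M) : Prop := Trm (fun e => F (e 0) (e 1)).
Definition Trm3 (F : M -> M -> M -> M) : Prop := Trm (fun e => F (e 0) (e 1) (e 2)).

Lemma Def1_app (P : M -> Prop) s : Def1 P -> Trm s -> Def (fun e => P (s e)).
Proof.
  intros H Hs. apply (Def_subst (fun x _ => P x)); [exact H|exact Hs].
Qed.

Lemma Def2_app (P : M -> M -> Prop) s t :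
  Def2 P -> Trm s -> Trm t -> Def (fun e => P (s e) (t e)).
Proof.
  intros H Hs Ht.
  apply (Def_subst (fun x e => P x (t e))); [|exact Hs].
  apply (Def_subst (fun y e => P (e 0) y)); [|exact (Trm_ren S t Ht)].
  exact (Def_ren _ (fun i => match i with 0 => 1 | _ => 0 end) H).
Qed.

Lemma Def3_app (P : M -> M -> M -> Prop) s t u :
  Def3 P -> Trm s -> Trm t -> Trm u -> Def (fun e => P (s e) (t e) (u e)).
Proof.
  intros H Hs Ht Hu.
  apply (Def_subst (fun x e => P x (t e) (u e))); [|exact Hs].
  apply (Def_subst (fun y e => P (e 0) y (u (fun i => e (S i))))); [|exact (Trm_ren S t Ht)].
  apply (Def_subst (fun z e => P (e 1) (e 0) z)); [|exact (Trm_ren (fun i => S (S i)) u Hu)].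
  exact (Def_ren _ (fun i => match i with 0 => 2 | 1 => 1 | _ => 0 end) H).
Qed.

Lemma Def4_app (P : M -> M -> M -> M -> Prop) s t u v :
  Def4 P -> Trm s -> Trm t -> Trm u -> Trm v ->
  Def (fun e => P (s e) (t e) (u e) (v e)).
Proof.
  intros H Hs Ht Hu Hv.
  apply (Def_subst (fun x e => P x (t e) (u e) (v e))); [|exact Hs].
  apply (Def_subst (fun y e => P (e 0) y (u (fun i => e (S i))) (v (fun i => e (S i)))));
    [|exact (Trm_ren S t Ht)].
  apply (Def_subst (fun z e => P (e 1) (e 0) z (v (fun i => e (S (S i))))));
    [|exact (Trm_ren (fun i => S (S i)) u Hu)].
  apply (Def_subst (fun w e => P (e 2) (e 1) (e 0) w));
    [|exact (Trm_ren (fun i => S (S (S i))) v Hv)].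
  exact (Def_ren _ (fun i => match i with 0 => 3 | 1 => 2 | 2 => 1 | _ => 0 end) H).
Qed.

Lemma Trm1_app (F : M -> M) s : Trm1 F -> Trm s -> Trm (fun e => F (s e)).
Proof.
  intros H Hs. apply (Def2_app (fun y x => y = F x)); [exact H|apply Trm_var|].
  exact (Trm_ren S s Hs).
Qed.

Lemma Trm2_app (F : M -> M -> M) s t :
  Trm2 F -> Trm s -> Trm t -> Trm (fun e => F (s e) (t e)).
Proof.
  intros H Hs Ht. apply (Def3_app (fun z x y => z = F x y)); [exact H|apply Trm_var| |].
  - exact (Trm_ren S s Hs).
  - exact (Trm_ren S t Ht).
Qed.

Lemma Trm3_app (F : M -> M -> M -> M) s t u :
  Trm3 F -> Trm s -> Trm t -> Trm u -> Trm (fun e => F (s e) (t e) (u e)).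
Proof.
  intros H Hs Ht Hu.
  apply (Def4_app (fun w x y z => w = F x y z)); [exact H|apply Trm_var| | |].
  - exact (Trm_ren S s Hs).
  - exact (Trm_ren S t Ht).
  - exact (Trm_ren S u Hu).
Qed.

Lemma Def_mem s t : Trm s -> Trm t -> Def (fun e => s e ∈ t e).
Proof.
  apply (Def2_app (fun x y => x ∈ y)).
  exists (f_mem 0 1), (fun i => inl i). intros e. simpl. tauto.
Qed.

Lemma Def_eq s t : Trm s -> Trm t -> Def (fun e => s e = t e).
Proof.
  apply (Def2_app (fun x y => x = y)).
  exists (f_eq 0 1), (fun i => inl i). intros e. simpl. tauto.
Qed.

(** The bridge to the schemes of [ZF], which want a bare formula and one environment. Parameters are
    stored in the environment, and the slots beyond the two arguments, on which [P] does not depend,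
    read [c0]. *)
Lemma Def2_sat (c0 : M) (P : M -> M -> Prop) :
  Def2 P -> exists p e, forall x y, P x y <-> sat (scons x (scons y e)) p.
Proof.
  intros [p [r K]].
  exists (ren (fun i => match r i with inl 0 => 0 | inl 1 => 1 | _ => S (S i) end) p).
  exists (fun i => match r i with inr c => c | inl _ => c0 end).
  intros x y. specialize (K (scons x (scons y (fun _ => c0)))). simpl in K.
  rewrite K, sat_ren.
  match goal with |- sat ?a _ <-> sat ?b _ => replace a with b; [tauto|] end.
  extensionality i. unfold look. destruct (r i) as [[|[|j]]|c] eqn:E; simpl; now rewrite ?E.
Qed.

End Definability.

Create HintDb defn.

(** * Definite descriptions, comprehension and replacement as definable operations *)

Section Description.
Context {M : structure} {HZF : ZF M}.

Lemma ZF_inhabited : inhabited M.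
Proof.
  destruct (ZF_infinity HZF) as [x _]. exact (inhabits x).
Qed.

(** The [default] makes [the P] definable from [P] even where the description fails. *)
Definition default : M := epsilon ZF_inhabited (fun _ => True).

Definition the (P : M -> Prop) : M :=
  epsilon ZF_inhabited
    (fun y => (exists! x, P x) /\ P y \/ ~ (exists! x, P x) /\ y = default).

Lemma the_cases (P : M -> Prop) :
  (exists! x, P x) /\ P (the P) \/ ~ (exists! x, P x) /\ the P = default.
Proof.
  unfold the. apply epsilon_spec.
  destruct (classic (exists! x, P x)) as [H|H].
  - destruct H as [x [Hx K]] eqn:E. exists x. left. split; [exact H|exact Hx].
  - exists default. now right.
Qed.

Lemma the_spec (P : M -> Prop) : (exists! x, P x) -> P (the P).
Proof.
  intros H. destruct (the_cases P) as [[_ K]|[K _]]; [exact K|contradiction].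
Qed.

Lemma the_eq (P : M -> Prop) a : (forall x, P x <-> x = a) -> the P = a.
Proof.
  intros H. apply H. apply the_spec. exists a. split; [now apply H|].
  intros x Hx. symmetry. now apply H.
Qed.

(** Both outcomes in [the_cases] are first-order conditions, with [default] as a parameter, and
    their disjunction is the graph. *)
Lemma Trm_the (Q : M -> (nat -> M) -> Prop) :
  Def (fun e => Q (e 0) (fun i => e (S i))) -> Trm (fun e => the (fun x => Q x e)).
Proof.
  intros H.
  assert (H1 : Def (fun e => exists x, Q x (fun i => e (S i)) /\
     forall y, Q y (fun i => e (S i)) -> x = y)).
  { apply Def_ex, Def_and.
    - exact (Def_ren _ (fun i => match i with 0 => 0 | S i => S (S i) end) H).
    - apply Def_all, Def_imp; [|apply Def_eq; apply Trm_var].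
      exact (Def_ren _ (fun i => match i with 0 => 0 | S i => S (S (S i)) end) H). }
  apply Def_ext with (fun e =>
    (exists x, Q x (fun i => e (S i)) /\ forall y, Q y (fun i => e (S i)) -> x = y)
      /\ Q (e 0) (fun i => e (S i)) \/
    ~ (exists x, Q x (fun i => e (S i)) /\ forall y, Q y (fun i => e (S i)) -> x = y)
      /\ e 0 = default).
  - intros e. set (P := fun x => Q x (fun i => e (S i))).
    change (((exists! x, P x) /\ P (e 0) \/ ~ (exists! x, P x) /\ e 0 = default)
      <-> e 0 = the P).
    destruct (the_cases P) as [[E H']|[E H']].
    + split.
      * intros [[_ K]|[K _]]; [|contradiction].
        destruct E as [x [_ E]]. now rewrite <- (E _ K), <- (E _ H').
      * intros ->. now left.
    + rewrite H'. tauto.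
  - apply Def_or; apply Def_and; try exact H1; [exact H|now apply Def_not|].
    apply Def_eq; [apply Trm_var|apply Trm_const].
Qed.

Definition ite (c : Prop) (a b : M) : M := the (fun y => c /\ y = a \/ ~ c /\ y = b).

Lemma ite_true (c : Prop) a b : c -> ite c a b = a.
Proof. intros H. apply the_eq. tauto. Qed.

Lemma ite_false (c : Prop) a b : ~ c -> ite c a b = b.
Proof. intros H. apply the_eq. tauto. Qed.

Definition compr (A : M) (P : M -> Prop) : M :=
  the (fun y => forall z, z ∈ y <-> z ∈ A /\ P z).

Definition repl (A : M) (F : M -> M) : M :=
  the (fun b => forall z, z ∈ b <-> exists x, x ∈ A /\ z = F x).

Lemma Trm_shift (s : (nat -> M) -> M) n :
  Trm s -> Trm (fun e => s (fun i => e (n + i))).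
Proof. apply (Trm_ren (fun i => n + i)). Qed.

Lemma Trm_ite (P : (nat -> M) -> Prop) (s t : (nat -> M) -> M) :
  Def P -> Trm s -> Trm t -> Trm (fun e => ite (P e) (s e) (t e)).
Proof.
  intros H Hs Ht.
  apply (Trm_the (fun y e => P e /\ y = s e \/ ~ P e /\ y = t e)).
  pose proof (Def_ren _ S H). pose proof (Trm_ren S _ Hs). pose proof (Trm_ren S _ Ht).
  apply Def_or; apply Def_and; auto using Def_not; apply Def_eq; auto using Trm_var.
Qed.

Lemma Trm_compr (s : (nat -> M) -> M) (Q : M -> (nat -> M) -> Prop) :
  Trm s -> Def (fun e => Q (e 0) (fun i => e (S i))) ->
  Trm (fun e => compr (s e) (fun z => Q z e)).
Proof.
  intros Hs H. apply (Trm_the (fun y e => forall z, z ∈ y <-> z ∈ s e /\ Q z e)).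
  apply Def_all, Def_iff; [apply Def_mem; apply Trm_var|apply Def_and].
  - apply Def_mem; [apply Trm_var|exact (Trm_shift s 2 Hs)].
  - exact (Def_ren _ (fun i => match i with 0 => 0 | S i => S (S i) end) H).
Qed.

Lemma Trm_repl (s : (nat -> M) -> M) (F : M -> (nat -> M) -> M) :
  Trm s -> Trm (fun e => F (e 0) (fun i => e (S i))) ->
  Trm (fun e => repl (s e) (fun z => F z e)).
Proof.
  intros Hs H.
  apply (Trm_the (fun y e => forall z, z ∈ y <-> exists x, x ∈ s e /\ z = F x e)).
  apply Def_all, Def_iff; [apply Def_mem; apply Trm_var|apply Def_ex, Def_and].
  - apply Def_mem; [apply Trm_var|exact (Trm_shift s 3 Hs)].
  - apply Def_eq; [apply Trm_var|].
    exact (Trm_ren (fun i => match i with 0 => 0 | S i => S (S (S i)) end) _ H).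
Qed.

End Description.

(** A hook, redefined once the variable-binding operators [fn] and [rec] are available. *)
Ltac def_extra := fail.

Ltac def_step :=
  cbv beta;
  lazymatch goal with
  | |- Def1 (fun _ => _) => unfold Def1
  | |- Def1 _ => first [assumption | solve [auto with defn nocore]]
  | |- Def2 (fun _ => _) => unfold Def2
  | |- Def2 _ => first [assumption | solve [auto with defn nocore]]
  | |- Def3 (fun _ => _) => unfold Def3
  | |- Def3 _ => first [assumption | solve [auto with defn nocore]]
  | |- Def4 (fun _ => _) => unfold Def4
  | |- Def4 _ => first [assumption | solve [auto with defn nocore]]
  | |- Trm1 (fun _ => _) => unfold Trm1
  | |- Trm1 _ => first [assumption | solve [auto with defn nocore]]
  | |- Trm2 (fun _ => _) => unfold Trm2
  | |- Trm2 _ => first [assumption | solve [auto with defn nocore]]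
  | |- Trm3 (fun _ => _) => unfold Trm3
  | |- Trm3 _ => first [assumption | solve [auto with defn nocore]]
  | |- Def (fun e => False) => apply Def_False
  | |- Def (fun e => True) => apply Def_True
  | |- Def (fun e => ~ _) => apply Def_not
  | |- Def (fun e => _ <-> _) => apply Def_iff
  | |- Def (fun e => _ /\ _) => apply Def_and
  | |- Def (fun e => _ \/ _) => apply Def_or
  | |- Def (fun e => ex (unique _)) => unfold unique
  | |- Def (fun e => exists x, _) => apply Def_ex
  | |- Def (fun e => _ -> _) => first [apply Def_imp | apply Def_all]
  | |- Def (fun e => forall x, _) => apply Def_all
  | |- Def (fun e => _ ∈ _) => apply Def_mem
  | |- Def (fun e => _ = _) => apply Def_eq
  | |- Trm (fun e => e _) => apply Trm_var
  | |- Trm (fun e => the _) => apply Trm_the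
  | |- Trm (fun e => ite _ _ _) => apply Trm_ite
  | |- Trm (fun e => compr _ _) => apply Trm_compr
  | |- Trm (fun e => repl _ _) => apply Trm_repl
  | |- Trm _ => first
      [ assumption
      | apply Trm_const
      | def_extra
      | lazymatch goal with |- Trm (fun e => ?F (@?s e) (@?t e) (@?u e)) =>
          apply (Trm3_app F s t u); [solve [repeat def_step]|..] end
      | lazymatch goal with |- Trm (fun e => ?F (@?s e) (@?t e)) =>
          apply (Trm2_app F s t); [solve [repeat def_step]|..] end
      | lazymatch goal with |- Trm (fun e => ?F (@?s e)) =>
          apply (Trm1_app F s); [solve [repeat def_step]|..] end ]
  | |- Def _ => first
      [ assumption
      | def_extra
      | lazymatch goal with |- Def (fun e => ?P (@?s e) (@?t e) (@?u e) (@?v e)) =>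
          apply (Def4_app P s t u v); [solve [repeat def_step]|..] end
      | lazymatch goal with |- Def (fun e => ?P (@?s e) (@?t e) (@?u e)) =>
          apply (Def3_app P s t u); [solve [repeat def_step]|..] end
      | lazymatch goal with |- Def (fun e => ?P (@?s e) (@?t e)) =>
          apply (Def2_app P s t); [solve [repeat def_step]|..] end
      | lazymatch goal with |- Def (fun e => ?P (@?s e)) =>
          apply (Def1_app P s); [solve [repeat def_step]|..] end ]
  end.

Ltac def := repeat def_step.

(** * Sets, pairs and functions *)

Section Sets.
Context {M : structure} {HZF : ZF M}.
Implicit Types x y z f g p q A B C : M.

Lemma set_ext x y : (forall z, z ∈ x <-> z ∈ y) -> x = y.
Proof. apply (ZF_extensionality HZF). Qed.

Lemma compr_spec A (P : M -> Prop) : Def1 P -> forall z, z ∈ compr A P <-> z ∈ A /\ P z.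
Proof.
  intros H. apply (the_spec (fun y => forall z, z ∈ y <-> z ∈ A /\ P z)).
  (* Separation has a single distinguished variable; the second argument of [Def2_sat] is a dummy,
     filled with [default] in the environment. *)
  destruct (Def2_sat default (fun x _ => P x)) as [p [e K]].
  { unfold Def2; def. }
  destruct (ZF_separation HZF p (scons default e) A) as [y Hy].
  exists y. split.
  - intros z. rewrite Hy, <- K. reflexivity.
  - intros y' Hy'. apply set_ext. intros z. rewrite Hy, Hy', <- K. reflexivity.
Qed.

Lemma repl_spec A (F : M -> M) :
  Trm1 F -> forall z, z ∈ repl A F <-> exists x, x ∈ A /\ z = F x.
Proof.
  intros H. apply (the_spec (fun y => forall z, z ∈ y <-> exists x, x ∈ A /\ z = F x)).
  destruct (Def2_sat default (fun z x => z = F x)) as [p [e K]].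
  { unfold Def2; def. }
  destruct (ZF_replacement HZF p e A) as [b Hb].
  { intros y _. exists (F y). split; [now apply K|]. intros z Hz. symmetry. now apply K. }
  assert (Hb' : forall z, z ∈ b <-> exists x, x ∈ A /\ z = F x).
  { intros z. rewrite Hb. split; intros [x [H1 H2]]; exists x; split; trivial; now apply K. }
  exists b. split; [exact Hb'|].
  intros y' Hy'. apply set_ext. intros z. now rewrite Hb', Hy'.
Qed.

Definition emp : M := the is_empty.
Definition upair x y : M := the (fun p => is_upair p x y).
Definition union x : M := the (fun u => is_union u x).
Definition power x : M := the (fun p => is_power p x).
Definition pair x y : M := the (fun p => is_pair p x y).
Definition succ x : M := the (fun y => is_succ y x).
Definition fst p : M := the (fun x => exists y, p = pair x y).
Definition snd p : M := the (fun y => exists x, p = pair x y).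
Definition app f x : M := the (fun y => rel f x y).
Definition app2 f x y : M := app f (pair x y).
Definition prod A B : M := the (fun Q => is_product Q A B).
Definition fn A (F : M -> M) : M := repl A (fun x => pair x (F x)).
Definition fn2 A B (F : M -> M -> M) : M := fn (prod A B) (fun p => F (fst p) (snd p)).

Lemma Def2_subset : Def2 (@subset M).
Proof. unfold Def2, subset; def. Qed.
Lemma Def3_is_upair : Def3 (@is_upair M).
Proof. unfold Def3, is_upair; def. Qed.
Lemma Def2_is_union : Def2 (@is_union M).
Proof. unfold Def2, is_union; def. Qed.
#[local] Hint Resolve Def2_subset Def3_is_upair Def2_is_union : defn.
Lemma Def2_is_power : Def2 (@is_power M).
Proof. unfold Def2, is_power; def. Qed.
Lemma Def2_is_succ : Def2 (@is_succ M).
Proof. unfold Def2, is_succ; def. Qed.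
Lemma Def3_is_pair : Def3 (@is_pair M).
Proof. unfold Def3, is_pair; def. Qed.
#[local] Hint Resolve Def2_is_power Def2_is_succ Def3_is_pair : defn.
Lemma Def3_rel : Def3 (@rel M).
Proof. unfold Def3, rel; def. Qed.
#[local] Hint Resolve Def3_rel : defn.
Lemma Def4_rel2 : Def4 (@rel2 M).
Proof. unfold Def4, rel2; def. Qed.
#[local] Hint Resolve Def4_rel2 : defn.
Lemma Def3_is_product : Def3 (@is_product M).
Proof. unfold Def3, is_product; def. Qed.
Lemma Def2_fun_on : Def2 (@fun_on M).
Proof. unfold Def2, fun_on; def. Qed.
#[local] Hint Resolve Def3_is_product Def2_fun_on : defn.
Lemma Def3_is_fun : Def3 (@is_fun M).
Proof. unfold Def3, is_fun; def. Qed.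
#[local] Hint Resolve Def3_is_fun : defn.
Lemma Trm2_pair : Trm2 pair.
Proof. unfold Trm2, pair; def. Qed.
Lemma Trm1_succ : Trm1 succ.
Proof. unfold Trm1, succ; def. Qed.
#[local] Hint Resolve Trm2_pair : defn.
Lemma Trm1_fst : Trm1 fst.
Proof. unfold Trm1, fst; def. Qed.
Lemma Trm1_snd : Trm1 snd.
Proof. unfold Trm1, snd; def. Qed.
Lemma Trm2_value : Trm2 app.
Proof. unfold Trm2, app; def. Qed.
#[local] Hint Resolve Trm2_value : defn.
Lemma Trm3_app2 : Trm3 app2.
Proof. unfold Trm3, app2; def. Qed.
#[local] Hint Resolve Trm1_succ Trm1_fst Trm1_snd Trm2_value Trm3_app2 : defn.

Lemma emp_spec x : ~ x ∈ emp.
Proof.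
  revert x. apply (the_spec is_empty).
  assert (H : forall z, ~ z ∈ compr default (fun _ => False)).
  { intros z Hz. apply compr_spec in Hz; [tauto|unfold Def1; def]. }
  exists (compr default (fun _ => False)). split; [exact H|].
  intros y Hy. apply set_ext. intros z. split; intros Hz; [now apply H in Hz|now apply Hy in Hz].
Qed.

Lemma upair_spec x y z : z ∈ upair x y <-> z = x \/ z = y.
Proof.
  revert z. apply (the_spec (fun p => is_upair p x y)).
  destruct (ZF_pairing HZF x y) as [p Hp]. exists p. split; [exact Hp|].
  intros q Hq. apply set_ext. intros z. now rewrite (Hp z), (Hq z).
Qed.

Lemma is_upair_iff p x y : is_upair p x y <-> p = upair x y.
Proof.
  split; [|intros ->; exact (upair_spec x y)].
  intros H. apply set_ext. intros z. now rewrite (H z), upair_spec.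
Qed.

Lemma union_spec x z : z ∈ union x <-> exists y, y ∈ x /\ z ∈ y.
Proof.
  revert z. apply (the_spec (fun p => is_union p x)).
  destruct (ZF_union HZF x) as [p Hp]. exists p. split; [exact Hp|].
  intros q Hq. apply set_ext. intros z. now rewrite (Hp z), (Hq z).
Qed.

Lemma power_spec x z : z ∈ power x <-> subset z x.
Proof.
  revert z. apply (the_spec (fun p => is_power p x)).
  destruct (ZF_power HZF x) as [p Hp]. exists p. split; [exact Hp|].
  intros q Hq. apply set_ext. intros z. now rewrite (Hp z), (Hq z).
Qed.

Lemma succ_spec x z : z ∈ succ x <-> z ∈ x \/ z = x.
Proof.
  revert z. apply (the_spec (fun p => is_succ p x)).
  assert (H : is_succ (union (upair x (upair x x))) x).
  { intros z. rewrite union_spec. split.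
    - intros [y [Hy Hz]]. apply upair_spec in Hy as [->| ->]; [now left|].
      apply upair_spec in Hz. tauto.
    - intros [Hz| ->].
      + exists x. split; [|exact Hz]. apply upair_spec. now left.
      + exists (upair x x). rewrite !upair_spec. tauto. }
  exists (union (upair x (upair x x))). split; [exact H|].
  intros q Hq. apply set_ext. intros z. now rewrite (H z), (Hq z).
Qed.

Lemma is_succ_iff y x : is_succ y x <-> y = succ x.
Proof.
  split; [|intros ->; exact (succ_spec x)].
  intros H. apply set_ext. intros z. now rewrite (H z), succ_spec.
Qed.

Lemma is_empty_iff x : is_empty x <-> x = emp.
Proof.
  split; [|intros ->; exact emp_spec].
  intros H. apply set_ext. intros z. split; intros Hz; [now apply H in Hz|now apply emp_spec in Hz].
Qed.

Lemma is_pair_iff p x y : is_pair p x y <-> p = pair x y.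
Proof.
  assert (H : forall q, is_pair q x y <-> q = upair (upair x x) (upair x y)).
  { intros q. unfold is_pair. split.
    - intros [s [t [Hs [Ht Hq]]]]. apply is_upair_iff in Hs, Ht, Hq. now subst.
    - intros ->. exists (upair x x), (upair x y). now rewrite !is_upair_iff. }
  unfold pair. rewrite (the_eq _ _ H). apply H.
Qed.

Lemma pair_inj x y x' y' : pair x y = pair x' y' -> x = x' /\ y = y'.
Proof.
  intros E.
  assert (H : is_pair (pair x y) x' y') by now apply is_pair_iff.
  assert (H' : is_pair (pair x y) x y) by now apply is_pair_iff.
  destruct H as [s [t [Hs [Ht Hp]]]], H' as [s' [t' [Hs' [Ht' Hp']]]].
  apply is_upair_iff in Hs, Ht, Hs', Ht'. subst.
  assert (K : forall z, z = upair x' x' \/ z = upair x' y' <-> z = upair x x \/ z = upair x y).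
  { intros z. now rewrite <- (Hp z), <- (Hp' z). }
  clear Hp Hp' E.
  assert (U : forall a b c d, upair a b = upair c d -> (a = c \/ a = d) /\ (b = c \/ b = d)
     /\ (c = a \/ c = b) /\ (d = a \/ d = b)).
  { intros a b c d E.
    assert (V : forall z, z = a \/ z = b <-> z = c \/ z = d).
    { intros z. now rewrite <- !upair_spec, E. }
    repeat split; apply V; tauto. }
  assert (x = x').
  { destruct (proj1 (K (upair x' x')) (or_introl eq_refl)) as [E|E];
    apply U in E; intuition. }
  subst x'. split; [reflexivity|].
  destruct (proj1 (K (upair x y')) (or_intror eq_refl)) as [E|E];
  destruct (proj2 (K (upair x y)) (or_intror eq_refl)) as [E'|E'];
  apply U in E; apply U in E'; intuition congruence.
Qed.

Lemma rel_iff f x y : rel f x y <-> pair x y ∈ f.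
Proof.
  unfold rel. split; [|intros H; exists (pair x y); now rewrite is_pair_iff].
  intros [p [Hp H]]. apply is_pair_iff in Hp. now subst.
Qed.

Lemma rel2_iff f x y z : rel2 f x y z <-> rel f (pair x y) z.
Proof.
  unfold rel2. split; [|intros H; exists (pair x y); now rewrite is_pair_iff].
  intros [p [Hp H]]. apply is_pair_iff in Hp. now subst.
Qed.

Lemma fst_pair x y : fst (pair x y) = x.
Proof.
  apply the_eq. intros z. split; [intros [w E]; now apply pair_inj in E|].
  intros ->. now exists y.
Qed.

Lemma snd_pair x y : snd (pair x y) = y.
Proof.
  apply the_eq. intros z. split; [intros [w E]; now apply pair_inj in E|].
  intros ->. now exists x.
Qed.

Lemma prod_spec A B p : p ∈ prod A B <-> exists x y, x ∈ A /\ y ∈ B /\ p = pair x y.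
Proof.
  set (P := fun p => exists x y, x ∈ A /\ y ∈ B /\ p = pair x y).
  assert (D : Def1 P) by (unfold Def1, P; def).
  (* Both members of a Kuratowski pair with components in [A] and [B] are subsets of A ∪ B, so the
     pair lies in the double power set of A ∪ B. *)
  set (T := compr (power (power (union (upair A B)))) P).
  assert (H : forall p, p ∈ T <-> P p).
  { intros q. unfold T. rewrite compr_spec by exact D. split; [tauto|].
    intros Hq. split; [|exact Hq].
    destruct Hq as [x [y [Hx [Hy Hq]]]]. apply is_pair_iff in Hq.
    destruct Hq as [s [t [Hs [Ht Hq]]]].
    assert (x ∈ union (upair A B) /\ y ∈ union (upair A B)) as [Ux Uy].
    { rewrite !union_spec. split; [exists A|exists B]; rewrite upair_spec; tauto. }
    apply power_spec. intros z Hz. apply power_spec. intros w Hw.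
    apply Hq in Hz as [->| ->]; [apply Hs in Hw|apply Ht in Hw]; destruct Hw as [->| ->];
    assumption. }
  assert (H' : forall Q, is_product Q A B <-> Q = T).
  { intros Q. split.
    - intros K. apply set_ext. intros z. rewrite (K z), (H z). unfold P.
      split; intros [x [y K']]; exists x, y; now rewrite is_pair_iff in *.
    - intros -> z. rewrite (H z). unfold P.
      split; intros [x [y K']]; exists x, y; now rewrite is_pair_iff in *. }
  unfold prod. rewrite (the_eq _ _ H'). apply H.
Qed.

Lemma pair_in_prod A B x y : pair x y ∈ prod A B <-> x ∈ A /\ y ∈ B.
Proof.
  rewrite prod_spec. split.
  - intros [x' [y' [Hx [Hy E]]]]. apply pair_inj in E as [-> ->]. tauto.
  - intros [Hx Hy]. now exists x, y.
Qed.

Lemma is_product_iff Q A B : is_product Q A B <-> Q = prod A B.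
Proof.
  assert (H : is_product (prod A B) A B).
  { intros p. rewrite prod_spec.
    split; intros [x [y K']]; exists x, y; now rewrite is_pair_iff in *. }
  split; [|now intros ->].
  intros K. apply set_ext. intros z. now rewrite (H z), (K z).
Qed.

Lemma rel_app f A x : fun_on f A -> x ∈ A -> rel f x (app f x).
Proof.
  intros [_ H] Hx. apply (the_spec (fun y => rel f x y)), H, Hx.
Qed.

Lemma rel_fun f A x y : fun_on f A -> (rel f x y <-> x ∈ A /\ y = app f x).
Proof.
  intros H. split.
  - intros K. assert (Hx : x ∈ A).
    { destruct K as [p [Hp K]]. destruct (proj1 H p K) as [x' [y' [Hx Hp']]].
      apply is_pair_iff in Hp, Hp'. subst p. now apply pair_inj in Hp' as [-> _]. }
    split; [exact Hx|].
    destruct (proj2 H x Hx) as [z [_ Hz]].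
    now rewrite <- (Hz _ K), <- (Hz _ (rel_app _ _ _ H Hx)).
  - intros [Hx ->]. now apply rel_app with A.
Qed.

Lemma app_in f A B x : is_fun f A B -> x ∈ A -> app f x ∈ B.
Proof.
  intros [H K] Hx. exact (K _ _ (rel_app _ _ _ H Hx)).
Qed.

Lemma fun_ext f g A :
  fun_on f A -> fun_on g A -> (forall x, x ∈ A -> app f x = app g x) -> f = g.
Proof.
  intros Hf Hg E.
  assert (K : forall u v, fun_on u A -> fun_on v A -> (forall x, x ∈ A -> app u x = app v x) ->
    forall p, p ∈ u -> p ∈ v).
  { intros u v Hu Hv E' p Hp. destruct (proj1 Hu p Hp) as [x [y [Hx H]]].
    apply is_pair_iff in H. subst p. apply rel_iff in Hp. apply rel_iff.
    apply (rel_fun u A) in Hp; [|exact Hu]. apply (rel_fun v A); [exact Hv|].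
    now rewrite <- E'. }
  apply set_ext. intros p. split; apply K; trivial. intros x Hx. symmetry. now apply E.
Qed.

Lemma fn_rel A (F : M -> M) x y : Trm1 F -> (rel (fn A F) x y <-> x ∈ A /\ y = F x).
Proof.
  intros H. rewrite rel_iff. unfold fn. rewrite repl_spec by (unfold Trm1; def).
  split.
  - intros [z [Hz E]]. now apply pair_inj in E as [-> ->].
  - intros [Hx ->]. now exists x.
Qed.

Lemma fn_fun_on A (F : M -> M) : Trm1 F -> fun_on (fn A F) A.
Proof.
  intros H. split.
  - intros p Hp. unfold fn in Hp. rewrite repl_spec in Hp by (unfold Trm1; def).
    destruct Hp as [x [Hx ->]]. exists x, (F x). now rewrite is_pair_iff.
  - intros x Hx. exists (F x). split; [now apply fn_rel|].
    intros y Hy. now apply fn_rel in Hy as [_ ->].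
Qed.

Lemma fn_app A (F : M -> M) x : Trm1 F -> x ∈ A -> app (fn A F) x = F x.
Proof.
  intros H Hx. apply the_eq. intros y. rewrite fn_rel by exact H. tauto.
Qed.

Lemma fn_is_fun A B (F : M -> M) :
  Trm1 F -> (forall x, x ∈ A -> F x ∈ B) -> is_fun (fn A F) A B.
Proof.
  intros H K. split; [now apply fn_fun_on|].
  intros x y Hy. apply fn_rel in Hy as [Hx ->]; auto.
Qed.

Lemma Trm_fn (s : (nat -> M) -> M) (F : M -> (nat -> M) -> M) :
  Trm s -> Trm (fun e => F (e 0) (fun i => e (S i))) ->
  Trm (fun e => fn (s e) (fun z => F z e)).
Proof.
  intros Hs HF. unfold fn. def.
Qed.

Lemma is_fun2_rel f A B C : is_fun2 f A B C ->
  forall x y z, rel2 f x y z <-> x ∈ A /\ y ∈ B /\ z = app2 f x y.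
Proof.
  intros [Q [HQ [Hf _]]] x y z. apply is_product_iff in HQ. subst Q.
  rewrite rel2_iff, (rel_fun _ _ _ _ Hf), pair_in_prod. unfold app2. tauto.
Qed.

Lemma app2_in f A B C x y : is_fun2 f A B C -> x ∈ A -> y ∈ B -> app2 f x y ∈ C.
Proof.
  intros Hf Hx Hy.
  assert (H : rel2 f x y (app2 f x y)) by now apply (is_fun2_rel f A B C).
  destruct Hf as [Q [HQ [Hf HC]]]. apply rel2_iff in H. exact (HC _ _ H).
Qed.

Lemma fn2_is_fun2 A B C (F : M -> M -> M) :
  Trm2 F -> (forall x y, x ∈ A -> y ∈ B -> F x y ∈ C) -> is_fun2 (fn2 A B F) A B C.
Proof.
  intros H K. exists (prod A B). split; [now apply is_product_iff|].
  apply fn_is_fun; [unfold Trm1; def|].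
  intros p Hp. apply prod_spec in Hp as [x [y [Hx [Hy ->]]]].
  rewrite fst_pair, snd_pair. now apply K.
Qed.

Lemma fn2_rel A B (F : M -> M -> M) x y z :
  Trm2 F -> (rel2 (fn2 A B F) x y z <-> x ∈ A /\ y ∈ B /\ z = F x y).
Proof.
  intros H. rewrite rel2_iff. unfold fn2. rewrite fn_rel by (unfold Trm1; def).
  rewrite pair_in_prod, fst_pair, snd_pair. tauto.
Qed.

End Sets.

#[export] Hint Resolve Def2_subset Def3_is_upair Def2_is_union
  Def2_is_power Def2_is_succ Def3_is_pair Def3_rel Def4_rel2 Def3_is_product Def2_fun_on
  Def3_is_fun Trm2_pair Trm1_succ Trm1_fst Trm1_snd Trm2_value Trm3_app2 : defn.

Ltac def_extra ::=
  lazymatch goal with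
  | |- Trm (fun e => fn _ _) => apply Trm_fn
  end.

(** * Natural numbers and recursion *)

Existing Class is_omega.

Section Naturals.
Context {M : structure} {HZF : ZF M}.

Lemma not_in_self (x : M) : ~ x ∈ x.
Proof.
  intros H. destruct (ZF_foundation HZF (upair x x)) as [y [Hy K]].
  { exists x. apply upair_spec. now left. }
  apply upair_spec in Hy. assert (y = x) by tauto. subst y.
  apply (K x H). apply upair_spec. now left.
Qed.

Context {omega : M} {Homega : is_omega omega}.
Implicit Types k m n : M.

Lemma omega_emp : emp ∈ omega.
Proof.
  destruct Homega as [[[e [He K]] _] _]. apply is_empty_iff in He. now subst.
Qed.

Lemma omega_succ n : n ∈ omega -> succ n ∈ omega.
Proof.
  intros Hn. destruct Homega as [[_ H] _]. destruct (H n Hn) as [z [Hz K]].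
  apply is_succ_iff in Hz. now subst.
Qed.

(** Induction is separation on [omega], hence restricted to definable [P]; this is the first goal of
    each use. *)
Lemma omega_ind (P : M -> Prop) : Def1 P -> P emp ->
  (forall n, n ∈ omega -> P n -> P (succ n)) -> forall n, n ∈ omega -> P n.
Proof.
  intros D H0 HS n Hn.
  destruct Homega as [_ H].
  assert (K : n ∈ compr omega P).
  { apply H; [|exact Hn]. split.
    - exists emp. split; [exact emp_spec|]. apply compr_spec; [exact D|].
      split; [exact omega_emp|exact H0].
    - intros y Hy. apply compr_spec in Hy as [Hy Py]; [|exact D].
      exists (succ y). split; [exact (succ_spec y)|]. apply compr_spec; [exact D|].
      split; [now apply omega_succ|now apply HS]. }
  now apply compr_spec in K.
Qed.

Lemma omega_trans m n : m ∈ n -> n ∈ omega -> m ∈ omega.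
Proof.
  intros Hm Hn. revert n Hn m Hm. apply (omega_ind (fun n => forall m, m ∈ n -> m ∈ omega)).
  - def.
  - intros m Hm. now apply emp_spec in Hm.
  - intros n Hn IH m Hm. apply succ_spec in Hm as [Hm| ->]; auto.
Qed.

Lemma nat_trans k m n : n ∈ omega -> k ∈ m -> m ∈ n -> k ∈ n.
Proof.
  intros Hn Hk Hm. revert n Hn m Hm k Hk.
  apply (omega_ind (fun n => forall m, m ∈ n -> forall k, k ∈ m -> k ∈ n)).
  - def.
  - intros m Hm. now apply emp_spec in Hm.
  - intros n Hn IH m Hm k Hk. apply succ_spec. left.
    apply succ_spec in Hm as [Hm| ->]; eauto.
Qed.

Lemma in_succ n : n ∈ succ n.
Proof. apply succ_spec. now right. Qed.

Lemma in_succ_of n k : k ∈ n -> k ∈ succ n.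
Proof. intros H. apply succ_spec. now left. Qed.

Lemma emp_in_succ n : n ∈ omega -> emp ∈ succ n.
Proof.
  revert n. apply (omega_ind (fun n => emp ∈ succ n)); [def|apply in_succ|].
  intros n Hn IH. now apply in_succ_of.
Qed.

Lemma succ_in_succ m n : n ∈ omega -> m ∈ n -> succ m ∈ succ n.
Proof.
  intros Hn Hm. revert n Hn m Hm.
  apply (omega_ind (fun n => forall m, m ∈ n -> succ m ∈ succ n)); [def| |].
  - intros m Hm. now apply emp_spec in Hm.
  - intros n Hn IH m Hm. apply succ_spec in Hm as [Hm| ->]; [|apply in_succ].
    apply in_succ_of. now apply IH.
Qed.

Lemma nat_trichotomy m n : m ∈ omega -> n ∈ omega -> m ∈ n \/ m = n \/ n ∈ m.
Proof.
  intros Hm Hn. revert n Hn m Hm.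
  apply (omega_ind (fun n => forall m, m ∈ omega -> m ∈ n \/ m = n \/ n ∈ m)); [def| |].
  - intros m Hm. right. pose proof (emp_in_succ m Hm) as H.
    apply succ_spec in H as [H|H]; auto.
  - intros n Hn IH m Hm. destruct (IH m Hm) as [H|[->|H]].
    + left. now apply in_succ_of.
    + left. apply in_succ.
    + right. pose proof (succ_in_succ n m Hm H) as K.
      apply succ_spec in K as [K|K]; auto.
Qed.

Lemma nat_not_both m n : n ∈ omega -> m ∈ n -> ~ n ∈ m.
Proof. intros Hn H K. exact (not_in_self n (nat_trans _ _ _ Hn K H)). Qed.

Lemma succ_inj m n : m ∈ omega -> n ∈ omega -> succ m = succ n -> m = n.
Proof.
  intros Hm Hn E. pose proof (in_succ m) as H. pose proof (in_succ n) as K.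
  rewrite E in H. rewrite <- E in K. apply succ_spec in H as [H|H], K as [K|K]; auto.
  now apply nat_not_both in H.
Qed.

Lemma succ_not_emp n : succ n <> emp.
Proof. intros E. apply (emp_spec n). rewrite <- E. apply in_succ. Qed.

(** [k ∈ succ n] plays the role of k ≤ n. *)
Lemma nat_le_lt m n : m ∈ omega -> n ∈ omega -> m ∈ succ n \/ n ∈ m.
Proof.
  intros Hm Hn. destruct (nat_trichotomy m n Hm Hn) as [H|[H|H]]; auto;
  left; apply succ_spec; auto.
Qed.

Lemma nat_le_trans k m n : n ∈ omega -> k ∈ succ m -> m ∈ succ n -> k ∈ succ n.
Proof.
  intros Hn Hk Hm. apply succ_spec in Hk as [Hk| ->]; [|exact Hm].
  apply (nat_trans _ m); trivial. now apply omega_succ.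
Qed.

Lemma nat_lt_le_trans k m n : n ∈ omega -> k ∈ m -> m ∈ succ n -> k ∈ n.
Proof.
  intros Hn Hk Hm. apply succ_spec in Hm as [Hm| ->]; [|exact Hk].
  now apply (nat_trans _ m).
Qed.

Lemma nat_upper m n : m ∈ omega -> n ∈ omega ->
  exists k, k ∈ omega /\ m ∈ k /\ n ∈ k.
Proof.
  intros Hm Hn. destruct (nat_le_lt m n Hm Hn) as [H|H].
  - exists (succ n). split; [now apply omega_succ|]. split; [exact H|apply in_succ].
  - exists (succ m). split; [now apply omega_succ|]. split; [apply in_succ|].
    now apply in_succ_of.
Qed.

(** The intersection of all sets closed under the recursion; stated as a
    predicate, it stays definable when [y0] and [F] have parameters. *)
Definition rec_graph (w y0 : M) (F : M -> M -> M) (n y : M) : Prop :=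
  forall W, pair emp y0 ∈ W ->
    (forall k v, k ∈ w -> pair k v ∈ W -> pair (succ k) (F k v) ∈ W) -> pair n y ∈ W.

Definition rec (w y0 : M) (F : M -> M -> M) (n : M) : M := the (rec_graph w y0 F n).

Lemma Def_rec_graph (y0 n y : (nat -> M) -> M) (F : M -> M -> (nat -> M) -> M) :
  Trm y0 -> Trm n -> Trm y -> Trm (fun e => F (e 0) (e 1) (fun i => e (S (S i)))) ->
  Def (fun e => rec_graph omega (y0 e) (fun k v => F k v e) (n e) (y e)).
Proof.
  intros Hy0 Hn Hy HF. unfold rec_graph. def.
  - exact (Trm_shift y0 1 Hy0).
  - exact (Trm_ren (fun i => match i with 0 => 1 | 1 => 0 | S (S i) => S (S (S i)) end) _ HF).
  - exact (Trm_shift n 1 Hn).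
  - exact (Trm_shift y 1 Hy).
Qed.

Lemma Trm_rec (y0 n : (nat -> M) -> M) (F : M -> M -> (nat -> M) -> M) :
  Trm y0 -> Trm n -> Trm (fun e => F (e 0) (e 1) (fun i => e (S (S i)))) ->
  Trm (fun e => rec omega (y0 e) (fun k v => F k v e) (n e)).
Proof.
  intros Hy0 Hn HF. unfold rec.
  apply (Trm_the (fun y e => rec_graph omega (y0 e) (fun k v => F k v e) (n e) y)).
  apply (Def_rec_graph (fun e => y0 (fun i => e (S i))) (fun e => n (fun i => e (S i)))
    (fun e => e 0) (fun k v e => F k v (fun i => e (S i)))).
  - exact (Trm_shift y0 1 Hy0).
  - exact (Trm_shift n 1 Hn).
  - apply Trm_var.
  - exact (Trm_ren (fun i => match i with 0 => 0 | 1 => 1 | S (S i) => S (S (S i)) end) _ HF).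
Qed.

Section Recursion.
Context (Y y0 : M) (F : M -> M -> M) (DF : Trm2 F) (Hy0 : y0 ∈ Y)
  (HF : forall k v, k ∈ omega -> v ∈ Y -> F k v ∈ Y).

Let G := rec_graph omega y0 F.

Lemma Def2_rec_graph : Def2 G.
Proof.
  apply (Def_rec_graph (fun _ => y0) (fun e => e 0) (fun e => e 1) (fun k v _ => F k v)).
  all: def.
Qed.
#[local] Hint Resolve Def2_rec_graph : defn.

Lemma rec_graph_emp : G emp y0.
Proof. intros W H0 _. exact H0. Qed.

Lemma rec_graph_succ n y : n ∈ omega -> G n y -> G (succ n) (F n y).
Proof. intros Hn H W H0 HS. apply HS; [exact Hn|]. now apply H. Qed.

(** Inversion for a least closed set: the pairs for which the conclusion holds are themselves closed
    under the recursion. The bound [Y] on the values makes these pairs a set, so that the quantifier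
    over [W] in [rec_graph] applies to it. *)
Lemma rec_graph_inv n y : G n y ->
  y ∈ Y /\ (n = emp -> y = y0) /\
  forall k, k ∈ omega -> n = succ k -> exists v, G k v /\ y = F k v.
Proof.
  set (P := fun p => G (fst p) (snd p) /\ snd p ∈ Y /\ (fst p = emp -> snd p = y0) /\
    forall k, k ∈ omega -> fst p = succ k -> exists v, G k v /\ snd p = F k v).
  assert (D : Def1 P) by (unfold P; def).
  intros H. assert (K : pair n y ∈ compr (prod omega Y) P).
  { apply H.
    - rewrite compr_spec by exact D. rewrite pair_in_prod. unfold P. rewrite fst_pair, snd_pair.
      repeat split; auto using omega_emp, rec_graph_emp.
      intros k _ E. symmetry in E. now apply succ_not_emp in E.
    - intros k v Hk. rewrite !compr_spec by exact D. rewrite !pair_in_prod. unfold P.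
      rewrite !fst_pair, !snd_pair.
      intros [[_ Hv] [HG _]]. repeat split; auto using omega_succ, rec_graph_succ.
      + intros E. now apply succ_not_emp in E.
      + intros k' Hk' E. apply succ_inj in E; trivial. subst k'. now exists v. }
  apply compr_spec in K as [_ K]; [|exact D]. unfold P in K. rewrite fst_pair, snd_pair in K.
  tauto.
Qed.

Lemma rec_graph_unique n : n ∈ omega -> exists! y, G n y.
Proof.
  revert n. apply (omega_ind (fun n => exists! y, G n y)); [def| |].
  - exists y0. split; [exact rec_graph_emp|].
    intros y Hy. apply rec_graph_inv in Hy as [_ [E _]]. symmetry. now apply E.
  - intros n Hn [y [Hy U]]. exists (F n y). split; [now apply rec_graph_succ|].
    intros z Hz. apply rec_graph_inv in Hz as [_ [_ K]].
    destruct (K n Hn eq_refl) as [v [Hv ->]]. now rewrite (U v Hv).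
Qed.

Lemma rec_emp : rec omega y0 F emp = y0.
Proof.
  apply (proj1 (proj2 (rec_graph_inv _ _ (the_spec _ (rec_graph_unique emp omega_emp))))).
  reflexivity.
Qed.

Lemma rec_succ n : n ∈ omega -> rec omega y0 F (succ n) = F n (rec omega y0 F n).
Proof.
  intros Hn. destruct (rec_graph_unique (succ n) (omega_succ n Hn)) as [y [Hy U]].
  assert (H : forall k, k ∈ omega -> G k (rec omega y0 F k))
    by (intros k Hk; exact (the_spec _ (rec_graph_unique k Hk))).
  rewrite <- (U _ (H _ (omega_succ n Hn))). apply U.
  apply rec_graph_succ; auto.
Qed.

Lemma rec_in n : n ∈ omega -> rec omega y0 F n ∈ Y.
Proof.
  intros Hn. apply (rec_graph_inv n). exact (the_spec _ (rec_graph_unique n Hn)).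
Qed.

End Recursion.

End Naturals.

#[export] Hint Resolve omega_emp omega_succ in_succ in_succ_of : core.

(** * Category in the Cantor space *)

Section Cantor.
Context {M : structure} {HZF : ZF M} {omega : M} {Homega : is_omega omega}.
Implicit Types k n m x y z : M.

Lemma bounded_values f n : n ∈ omega -> (forall k, k ∈ n -> app f k ∈ omega) ->
  exists b, b ∈ omega /\ forall k, k ∈ n -> app f k ∈ b.
Proof.
  revert n. apply (omega_ind (fun n => (forall k, k ∈ n -> app f k ∈ omega) ->
    exists b, b ∈ omega /\ forall k, k ∈ n -> app f k ∈ b)); [def| |].
  - intros _. exists emp. split; [exact omega_emp|]. intros k Hk. now apply emp_spec in Hk.
  - intros n Hn IH H. destruct IH as [b [Hb IH]]; [auto|].
    destruct (nat_upper b (app f n) Hb) as [c [Hc [Hbc Hfc]]]; [auto|].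
    exists c. split; [exact Hc|]. intros k Hk. apply succ_spec in Hk as [Hk| ->]; [|exact Hfc].
    exact (nat_trans _ _ _ Hc (IH k Hk) Hbc).
Qed.

(** Lets initial segments of [omega] replace the arbitrary finite sets of coordinates in
    [cantor_open]; [agree n] then describes a base of neighbourhoods. *)
Lemma finite_bounded F : subset F omega -> finite omega F ->
  exists b, b ∈ omega /\ subset F b.
Proof.
  intros HF [n [f [Hn [[Hf Hv] Hb]]]].
  destruct (bounded_values f n Hn) as [b [Hbo K]].
  { intros k Hk. apply HF, (app_in f n); [now split|exact Hk]. }
  exists b. split; [exact Hbo|]. intros y Hy. destruct (Hb y Hy) as [x [Hx _]].
  apply (rel_fun f n) in Hx as [Hx ->]; [now apply K|exact Hf].
Qed.

Lemma nat_finite n : n ∈ omega -> finite omega n.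
Proof.
  intros Hn. exists n, (fn n (fun k => k)). split; [exact Hn|].
  split; [apply fn_is_fun; [def|auto]|].
  intros y Hy. exists y. split; [apply fn_rel; [def|auto]|].
  intros x Hx. apply fn_rel in Hx as [_ ->]; [reflexivity|def].
Qed.

Definition zero : M := emp.
Definition one : M := succ emp.
Definition two : M := upair zero one.
Definition cantor (w : M) : M := compr (power (prod w two)) (fun x => is_fun x w two).
Notation C := (cantor omega).

Lemma zero_neq_one : zero <> one.
Proof. intros E. exact (succ_not_emp _ (eq_sym E)). Qed.

Lemma two_spec x : x ∈ two <-> x = zero \/ x = one.
Proof. apply upair_spec. Qed.

Lemma cantor_spec x : x ∈ C <-> is_fun x omega two.
Proof.
  unfold cantor. rewrite compr_spec by def. split; [tauto|]. intros H. split; [|exact H].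
  apply power_spec. intros p Hp. destruct H as [Hx HB].
  destruct (proj1 Hx p Hp) as [k [v [Hk E]]]. apply is_pair_iff in E. subst p.
  apply pair_in_prod. split; [exact Hk|]. apply (HB k). now apply rel_iff.
Qed.

Lemma cantor_is_cantor : is_cantor omega C.
Proof.
  exists two. split; [|exact cantor_spec].
  intros x. rewrite two_spec. split.
  - intros [->| ->]; [left; exact emp_spec|]. right. exists emp. split; [exact emp_spec|].
    now apply is_succ_iff.
  - intros [H|[e [He H]]]; [left; now apply is_empty_iff|right].
    apply is_empty_iff in He. apply is_succ_iff in H. now subst.
Qed.

Lemma cantor_app x k : x ∈ C -> k ∈ omega -> app x k ∈ two.
Proof. intros Hx Hk. apply cantor_spec in Hx. now apply (app_in x omega). Qed.

Lemma cantor_fun_on x : x ∈ C -> fun_on x omega.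
Proof. intros Hx. now apply cantor_spec in Hx as [H _]. Qed.

Lemma cantor_ext x y : x ∈ C -> y ∈ C ->
  (forall k, k ∈ omega -> app x k = app y k) -> x = y.
Proof. intros Hx Hy. apply fun_ext; now apply cantor_fun_on. Qed.

Definition agree n x y : Prop := forall k, k ∈ n -> app x k = app y k.

Lemma Def3_agree : Def3 agree.
Proof. unfold Def3, agree. def. Qed.
#[local] Hint Resolve Def3_agree : defn.

Lemma agree_weaken m n x y : n ∈ omega -> m ∈ succ n -> agree n x y -> agree m x y.
Proof. intros Hn Hm H k Hk. apply H. now apply (nat_lt_le_trans _ m). Qed.

Lemma agree_trans n x y z : agree n x y -> agree n y z -> agree n x z.
Proof. intros H K k Hk. now rewrite H, K. Qed.

Lemma agree_open n x : n ∈ omega -> cantor_open omega C (compr C (fun y => agree n x y)).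
Proof.
  intros Hn. split.
  - intros y Hy. apply compr_spec in Hy; [tauto|def].
  - intros y Hy. apply compr_spec in Hy as [Hy Hxy]; [|def].
    exists n. split; [intros k Hk; now apply (omega_trans k n)|].
    split; [now apply nat_finite|].
    intros z Hz K. apply compr_spec; [def|]. split; [exact Hz|].
    apply (agree_trans _ _ y); [exact Hxy|]. intros k Hk.
    assert (Hk' : k ∈ omega) by now apply (omega_trans k n).
    apply (rel_fun z omega); [now apply cantor_fun_on|].
    apply (K k (app y k) Hk). apply rel_app with omega; [now apply cantor_fun_on|exact Hk'].
Qed.

Lemma open_agree U x : cantor_open omega C U -> x ∈ U ->
  exists n, n ∈ omega /\ forall y, y ∈ C -> agree n x y -> y ∈ U.
Proof.
  intros [HU H] Hx. destruct (H x Hx) as [F [HF [Fin K]]].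
  destruct (finite_bounded F HF Fin) as [n [Hn Hb]].
  exists n. split; [exact Hn|]. intros y Hy E. apply K; [exact Hy|].
  intros k i Hk.
  rewrite (rel_fun x omega), (rel_fun y omega) by (apply cantor_fun_on; auto).
  now rewrite (E k) by auto.
Qed.

(** Nowhere density in terms of cylinders. It is stated for Rocq predicates, so that unions and
    preimages need not be formed as sets. The strict [n ∈ m] forces the lengths of successive
    cylinders to grow, so that in [generic_point] they shrink to a point. *)
Definition thin (K : M -> Prop) : Prop :=
  forall x n, x ∈ C -> n ∈ omega -> exists y m, y ∈ C /\ m ∈ omega /\ n ∈ m /\
    agree n x y /\ forall z, z ∈ C -> agree m y z -> ~ K z.

(** If no smaller cylinder inside the one of [x] and [n] missed [K], every point of the latter would
    be adherent to [K]. *)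
Lemma nowhere_dense_thin K :
  nowhere_dense C (cantor_open omega C) K -> thin (fun z => z ∈ K).
Proof.
  intros [_ H] x n Hx Hn. apply NNPP. intros N. apply H.
  exists (compr C (fun y => agree n x y)). split; [now apply agree_open|]. split.
  { exists x. apply compr_spec; [def|]. now split; [|intros k _]. }
  intros y Hy. apply compr_spec in Hy as [Hy Hxy]; [|def]. split; [exact Hy|].
  intros U HU Hyu. destruct (open_agree U y HU Hyu) as [m [Hm K']].
  apply NNPP. intros N'. apply N.
  destruct (nat_upper n m Hn Hm) as [k [Hk [Hnk Hmk]]].
  exists y, k. repeat split; trivial.
  intros z Hz Hyz Hzk. apply N'. exists z. split; [|exact Hzk].
  apply K'; [exact Hz|]. apply (agree_weaken m k); auto.
Qed.

Lemma thin_sub (K K' : M -> Prop) :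
  (forall z, z ∈ C -> K' z -> K z) -> thin K -> thin K'.
Proof.
  intros H T x n Hx Hn. destruct (T x n Hx Hn) as [y [m [Hy [Hm [Hnm [E A]]]]]].
  exists y, m. repeat split; auto. intros z Hz Hyz Hk. apply (A z); auto.
Qed.

Lemma thin_or (K K' : M -> Prop) : thin K -> thin K' -> thin (fun z => K z \/ K' z).
Proof.
  intros T T' x n Hx Hn. destruct (T x n Hx Hn) as [y [m [Hy [Hm [Hnm [E A]]]]]].
  destruct (T' y m Hy Hm) as [y' [m' [Hy' [Hm' [Hmm' [E' A']]]]]].
  exists y', m'. repeat split; trivial.
  - exact (nat_trans _ _ _ Hm' Hnm Hmm').
  - apply (agree_trans _ _ y); [exact E|]. apply (agree_weaken n m); auto.
  - intros z Hz Hyz [K1|K1]; [|now apply (A' z)].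
    apply (A z); trivial. apply (agree_trans _ _ y'); [exact E'|].
    apply (agree_weaken m m'); auto.
Qed.

Definition flip (w j x : M) : M :=
  fn w (fun k => ite (k = j) (ite (app x k = zero) one zero) (app x k)).

Lemma flip_app_ne j x k : k ∈ omega -> k <> j -> app (flip omega j x) k = app x k.
Proof.
  intros Hk N. unfold flip. rewrite fn_app; [|def|exact Hk]. now rewrite ite_false.
Qed.

Lemma flip_app_eq j x : j ∈ omega ->
  app (flip omega j x) j = ite (app x j = zero) one zero.
Proof.
  intros Hk. unfold flip. rewrite fn_app; [|def|exact Hk]. now rewrite ite_true.
Qed.

Lemma flip_one j x : j ∈ omega -> x ∈ C ->
  (app (flip omega j x) j = one <-> app x j <> one).
Proof.
  intros Hj Hx. rewrite flip_app_eq by exact Hj.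
  pose proof zero_neq_one. destruct (proj1 (two_spec _) (cantor_app x j Hx Hj)) as [E|E];
  rewrite E.
  - rewrite ite_true by reflexivity. tauto.
  - rewrite ite_false by congruence. tauto.
Qed.

Lemma flip_in j x : x ∈ C -> flip omega j x ∈ C.
Proof.
  intros Hx. apply cantor_spec. unfold flip. apply fn_is_fun; [def|].
  intros k Hk.
  assert (Z : zero ∈ two /\ one ∈ two) by (rewrite !two_spec; tauto).
  destruct (classic (k = j)) as [E|E]; [rewrite ite_true by exact E|].
  - destruct (classic (app x k = zero)) as [E'|E'];
    [rewrite ite_true by exact E'|rewrite ite_false by exact E']; tauto.
  - rewrite ite_false by exact E. now apply cantor_app.
Qed.

Lemma flip_ne j x : j ∈ omega -> x ∈ C -> app (flip omega j x) j <> app x j.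
Proof.
  intros Hj Hx E. pose proof (flip_one j x Hj Hx) as H. rewrite E in H. tauto.
Qed.

Lemma two_other a b c : a ∈ two -> b ∈ two -> c ∈ two -> a <> b -> c <> b -> a = c.
Proof. rewrite !two_spec. intuition congruence. Qed.

Lemma flip_flip j x : j ∈ omega -> x ∈ C -> flip omega j (flip omega j x) = x.
Proof.
  intros Hj Hx. apply cantor_ext; auto using flip_in.
  intros k Hk. destruct (classic (k = j)) as [->|N].
  - apply (two_other _ (app (flip omega j x) j)); auto using cantor_app, flip_in.
    + apply flip_ne; auto using flip_in.
    + intros E. symmetry in E. now apply flip_ne in E.
  - now rewrite !flip_app_ne.
Qed.

Lemma agree_flip n j x y : n ∈ omega -> agree n x y ->
  agree n (flip omega j x) (flip omega j y).
Proof.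
  intros Hn H k Hk. pose proof (omega_trans _ _ Hk Hn).
  destruct (classic (k = j)) as [->|N].
  - rewrite !flip_app_eq by trivial. now rewrite (H j).
  - rewrite !flip_app_ne by trivial. now apply H.
Qed.

(** Flipping digit [j] is an involution that preserves [agree n], so it carries cylinders to
    cylinders of the same length. *)
Lemma thin_flip j (K : M -> Prop) : j ∈ omega -> thin K -> thin (fun z => K (flip omega j z)).
Proof.
  intros Hj T x n Hx Hn.
  destruct (T (flip omega j x) n (flip_in j x Hx) Hn) as [y [m [Hy [Hm [Hnm [E A]]]]]].
  exists (flip omega j y), m. repeat split; auto using flip_in.
  - rewrite <- (flip_flip j x Hj Hx). now apply agree_flip.
  - intros z Hz Hyz. apply A; [now apply flip_in|].
    rewrite <- (flip_flip j y Hj Hy). now apply agree_flip.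
Qed.

(** For [n] ranging over [omega], this is eventual equality E_0 on the Cantor space, graded by where
    the changes stop. *)
Definition off (w n x y : M) : Prop := forall k, k ∈ w -> ~ k ∈ n -> app x k = app y k.

(** Changing the first [n] digits in all ways gives a finite union of flipped copies of [N].
    Inductively, a change below [succ n] is a change below [n], preceded by a flip of digit [n] when
    that digit is wrong. *)
Lemma thin_off N n : n ∈ omega -> thin (fun z => z ∈ N) ->
  thin (fun z => exists y, y ∈ N /\ y ∈ C /\ off omega n z y).
Proof.
  intros Hn T. revert n Hn.
  apply (omega_ind (fun n => thin (fun z => exists y, y ∈ N /\ y ∈ C /\ off omega n z y))).
  - unfold thin, off. def.
  - apply (thin_sub (fun z => z ∈ N)); [|exact T].
    intros z Hz [y [Hy [Hyc H]]]. replace z with y; [exact Hy|].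
    symmetry. apply cantor_ext; trivial. intros k Hk. apply H; [exact Hk|apply emp_spec].
  - intros n Hn IH.
    set (K := fun z => exists y, y ∈ N /\ y ∈ C /\ off omega n z y) in *.
    apply (thin_sub (fun z => K z \/ K (flip omega n z)));
      [|now apply thin_or; [|apply thin_flip]].
    intros z Hz [y [Hy [Hyc H]]].
    assert (H' : forall k, k ∈ omega -> ~ k ∈ n -> k <> n -> app z k = app y k).
    { intros k Hk N1 N2. apply H; [exact Hk|]. rewrite succ_spec. tauto. }
    destruct (classic (app z n = app y n)) as [E|E]; [left|right]; exists y;
    repeat split; trivial; intros k Hk Nk; destruct (classic (k = n)) as [->|Nn]; auto.
    + apply (two_other _ (app z n)); auto using cantor_app, flip_in, flip_ne.
    + rewrite flip_app_ne by trivial. auto.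
Qed.

(** One index bounds both the position of the changed digits and the index of the set [app N i].
    This gives an increasing sequence of thin predicates that together contain all finite
    modifications of all points of the [app N i]. *)
Definition blur (w N n z : M) : Prop :=
  exists i y, i ∈ n /\ y ∈ app N i /\ y ∈ cantor w /\ off w n z y.

Lemma Def3_blur : Def3 (blur omega).
Proof. unfold blur, off, cantor. def. Qed.
#[local] Hint Resolve Def3_blur : defn.

Lemma thin_union N n : n ∈ omega ->
  (forall i, i ∈ omega -> thin (fun z => z ∈ app N i)) ->
  thin (fun z => exists i, i ∈ n /\ z ∈ app N i).
Proof.
  intros Hn T. revert n Hn.
  apply (omega_ind (fun n => thin (fun z => exists i, i ∈ n /\ z ∈ app N i))).
  - unfold thin. def.
  - intros x n Hx Hn. exists x, (succ n). repeat split; auto.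
    intros z _ _ [i [Hi _]]. now apply emp_spec in Hi.
  - intros n Hn IH.
    apply (thin_sub (fun z => (exists i, i ∈ n /\ z ∈ app N i) \/ z ∈ app N n));
      [|apply thin_or; auto].
    intros z _ [i [Hi Hz]]. apply succ_spec in Hi as [Hi| ->]; [left|now right].
    now exists i.
Qed.

Lemma thin_blur N n : n ∈ omega ->
  (forall i, i ∈ omega -> thin (fun z => z ∈ app N i)) -> thin (blur omega N n).
Proof.
  intros Hn T.
  (* [thin_off] speaks of a set, so the finite union is first made into one. *)
  set (A := compr C (fun z => exists i, i ∈ n /\ z ∈ app N i)).
  assert (HA : forall z, z ∈ A <-> z ∈ C /\ exists i, i ∈ n /\ z ∈ app N i).
  { intros z. unfold A. rewrite compr_spec by def. tauto. }
  apply (thin_sub (fun z => exists y, y ∈ A /\ y ∈ C /\ off omega n z y)).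
  - intros z Hz [i [y [Hi [Hy [Hyc H]]]]]. exists y. rewrite HA.
    split; [split; [exact Hyc|now exists i]|now split].
  - apply thin_off; [exact Hn|].
    apply (thin_sub (fun z => exists i, i ∈ n /\ z ∈ app N i)); [|now apply thin_union].
    intros z _ Hz. now apply HA in Hz.
Qed.

Lemma blur_mono N m n z : n ∈ omega -> m ∈ succ n -> blur omega N m z -> blur omega N n z.
Proof.
  intros Hn Hm [i [y [Hi [Hy [Hyc H]]]]]. exists i, y. repeat split; trivial.
  - now apply (nat_lt_le_trans _ m).
  - intros k Hk Nk. apply H; [exact Hk|]. intros K. apply Nk.
    now apply (nat_lt_le_trans _ m).
Qed.

Context (HDC : DC omega).

Lemma dependent_choice X (P : M -> M -> Prop) : Def2 P -> (exists x, x ∈ X) ->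
  (forall x, x ∈ X -> exists y, y ∈ X /\ P x y) ->
  exists s, (forall n, n ∈ omega -> app s n ∈ X) /\
    forall n, n ∈ omega -> P (app s n) (app s (succ n)).
Proof.
  intros D Hne Hs.
  set (R := compr (prod X X) (fun p => P (fst p) (snd p))).
  assert (HR : forall x y, rel R x y <-> x ∈ X /\ y ∈ X /\ P x y).
  { intros x y. rewrite rel_iff. unfold R. rewrite compr_spec by def.
    rewrite pair_in_prod, fst_pair, snd_pair. tauto. }
  destruct (HDC X R Hne) as [s [Hf H]].
  - intros p Hp. unfold R in Hp. rewrite compr_spec in Hp by def.
    destruct Hp as [Hp _]. apply prod_spec in Hp as [x [y [Hx [Hy ->]]]].
    exists x, y. rewrite is_pair_iff. auto.
  - intros x Hx. destruct (Hs x Hx) as [y [Hy K]]. exists y. now rewrite HR.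
  - exists s. split; [intros n Hn; now apply (app_in s omega)|].
    intros n Hn. apply HR.
    apply (H n (succ n)); [exact Hn|now apply is_succ_iff| |];
    (apply rel_app with omega; [apply Hf|auto]).
Qed.

(** The Baire category theorem, for a point all of whose finite modifications
    avoid the given nowhere dense sets. *)
Lemma generic_point N : (forall i, i ∈ omega -> thin (fun z => z ∈ app N i)) ->
  exists x, x ∈ C /\ forall n, n ∈ omega -> ~ blur omega N n x.
Proof.
  intros T.
  (* A state is a point with a length, read as a cylinder. The cylinder of [q] refines that of [p],
     is longer, and misses [blur] at the old length. The relation for DC cannot see the stage; by
     [Hlen] the length is at least the stage, so [blur_mono] covers every index. *)
  set (P := fun p q => agree (snd p) (fst p) (fst q) /\ snd p ∈ snd q /\
    forall z, z ∈ C -> agree (snd q) (fst q) z -> ~ blur omega N (snd p) z).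
  assert (D : Def2 P) by (unfold P, cantor; def).
  destruct (dependent_choice (prod C omega) P D) as [s [Hs HP]].
  { exists (pair (fn omega (fun _ => zero)) emp). apply pair_in_prod.
    split; [|exact omega_emp]. apply cantor_spec, fn_is_fun; [def|].
    intros k _. apply two_spec. now left. }
  { intros p Hp. apply prod_spec in Hp as [x [n [Hx [Hn ->]]]].
    destruct (thin_blur N n Hn T x n Hx Hn) as [y [m [Hy [Hm [Hnm [E A]]]]]].
    exists (pair y m). rewrite pair_in_prod. unfold P. rewrite !fst_pair, !snd_pair. auto. }
  set (y := fun i => fst (app s i)). set (l := fun i => snd (app s i)).
  assert (Hyl : forall i, i ∈ omega -> y i ∈ C /\ l i ∈ omega).
  { intros i Hi. pose proof (Hs i Hi) as H. apply prod_spec in H as [a [b [Ha [Hb E]]]].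
    unfold y, l. rewrite E, fst_pair, snd_pair. auto. }
  assert (Hy : forall i, i ∈ omega -> y i ∈ C) by (intros i Hi; now apply Hyl).
  assert (Hl : forall i, i ∈ omega -> l i ∈ omega) by (intros i Hi; now apply Hyl).
  assert (Hstep : forall i, i ∈ omega -> agree (l i) (y i) (y (succ i)) /\ l i ∈ l (succ i) /\
    forall z, z ∈ C -> agree (l (succ i)) (y (succ i)) z -> ~ blur omega N (l i) z)
    by exact HP.
  assert (Dy : Trm1 y) by (unfold y; def). assert (Dl : Trm1 l) by (unfold l; def).
  clearbody y l. clear HP Hs D Hyl P.
  assert (Hlen : forall i, i ∈ omega -> i ∈ succ (l i)).
  { apply omega_ind; [def| |].
    - apply emp_in_succ, Hl, omega_emp.
    - intros i Hi IH. pose proof (Hl _ (omega_succ i Hi)) as Hl'.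
      apply succ_in_succ; [exact Hl'|].
      destruct (Hstep i Hi) as [_ [Hi' _]]. apply succ_spec in IH as [IH|IH].
      + now apply (nat_trans _ (l i)).
      + now rewrite IH at 1. }
  assert (Hchain : forall j, j ∈ omega -> forall i, i ∈ succ j ->
    agree (l i) (y i) (y j) /\ l i ∈ succ (l j)).
  { apply (omega_ind (fun j => forall i, i ∈ succ j ->
      agree (l i) (y i) (y j) /\ l i ∈ succ (l j))); [def| |].
    - intros i Hi. apply succ_spec in Hi as [Hi| ->]; [now apply emp_spec in Hi|].
      split; [now intros k _|auto].
    - intros j Hj IH i Hi. apply succ_spec in Hi as [Hi| ->]; [|now split; [intros k _|]].
      destruct (IH i Hi) as [E Hli]. destruct (Hstep j Hj) as [E' [Hlj _]].
      split.
      + apply (agree_trans _ _ (y j)); [exact E|]. apply (agree_weaken _ (l j)); auto.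
      + apply (nat_le_trans _ (l j)); auto. }
  (* By [Hlen] the cylinder at stage [succ k] has length greater than [k], so digit [k] no longer
     changes from there on. *)
  set (x := fn omega (fun k => app (y (succ k)) k)).
  assert (Hx : x ∈ C).
  { apply cantor_spec, fn_is_fun; [def|]. intros k Hk. apply cantor_app; auto. }
  assert (Hxy : forall i, i ∈ omega -> agree (l i) (y i) x).
  { intros i Hi k Hk. assert (Hko : k ∈ omega) by (apply (omega_trans k (l i)); auto).
    unfold x. rewrite fn_app; [|def|exact Hko].
    destruct (nat_le_lt i (succ k) Hi (omega_succ k Hko)) as [Hik|Hik].
    - now apply Hchain; [apply omega_succ| |].
    - symmetry. apply (Hchain i Hi (succ k)); [now apply in_succ_of|].
      apply (nat_lt_le_trans _ (succ k)); auto. }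
  exists x. split; [exact Hx|]. intros n Hn Hb.
  apply (proj2 (proj2 (Hstep n Hn)) x Hx); [now apply Hxy; apply omega_succ|].
  apply (blur_mono N n); auto.
Qed.

Lemma meager_generic D : meager omega C (cantor_open omega C) D ->
  exists x, x ∈ C /\ forall n y, n ∈ omega -> y ∈ C -> off omega n x y -> ~ y ∈ D.
Proof.
  intros [N [HN [Hnd HD]]].
  destruct (generic_point N) as [x [Hx H]].
  { intros i Hi. apply nowhere_dense_thin, (Hnd i), rel_app with omega; trivial. }
  exists x. split; [exact Hx|]. intros n y Hn Hy E Hyd.
  apply HD in Hyd as [i [K [Hi HyK]]]. apply (rel_fun N omega) in Hi as [Hi ->]; [|exact HN].
  (* The bound [n] on the changed digits and the index [i] of the nowhere dense set are absorbed
     into one [m], as [blur] demands. *)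
  destruct (nat_upper n i Hn Hi) as [m [Hm [Hnm Him]]].
  apply (H m Hm). exists i, y. repeat split; trivial.
  intros k Hk Nk. apply E; [exact Hk|]. intros Hkn. apply Nk. now apply (nat_trans _ n).
Qed.

End Cantor.

#[export] Hint Resolve Def3_agree Def3_blur : defn.

(** * Groups and real numbers *)

Section Groups.
Context {M : structure} {HZF : ZF M}.

Lemma Def3_neutral : Def3 (@neutral M).
Proof. unfold Def3, neutral. def. Qed.
#[local] Hint Resolve Def3_neutral : defn.

Definition unit (A m : M) : M := the (fun e => neutral A m e).

Lemma Trm2_unit : Trm2 unit.
Proof. unfold Trm2, unit. def. Qed.

Context {A m : M} (HG : group A m).

Lemma mul_rel x y z : rel2 m x y z <-> x ∈ A /\ y ∈ A /\ z = app2 m x y.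
Proof. destruct HG as [H _]. now apply (is_fun2_rel m A A A). Qed.

Lemma mul_in x y : x ∈ A -> y ∈ A -> app2 m x y ∈ A.
Proof. destruct HG as [H _]. now apply (app2_in m A A A). Qed.

Lemma neutral_eq e e' : neutral A m e -> neutral A m e' -> e = e'.
Proof.
  intros [He H] [He' H'].
  destruct (H e' He') as [K _], (H' e He) as [_ K'].
  apply mul_rel in K as [_ [_ K]]. apply mul_rel in K' as [_ [_ K']]. congruence.
Qed.

Lemma neutral_iff e : neutral A m e <-> e = unit A m.
Proof.
  assert (H : neutral A m (unit A m)).
  { apply (the_spec (fun e => neutral A m e)).
    destruct HG as [_ [_ [e0 [He _]]]]. exists e0. split; [exact He|].
    intros e'. now apply neutral_eq. }
  split; [intros K; now apply neutral_eq|now intros ->].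
Qed.

Lemma unit_in : unit A m ∈ A.
Proof. now apply (proj2 (neutral_iff _) eq_refl). Qed.

Lemma mul_1l x : x ∈ A -> app2 m (unit A m) x = x.
Proof.
  intros Hx. destruct (proj2 (neutral_iff _) eq_refl) as [_ H].
  destruct (H x Hx) as [K _]. symmetry. now apply mul_rel in K.
Qed.

Lemma mul_1r x : x ∈ A -> app2 m x (unit A m) = x.
Proof.
  intros Hx. destruct (proj2 (neutral_iff _) eq_refl) as [_ H].
  destruct (H x Hx) as [_ K]. symmetry. now apply mul_rel in K.
Qed.

Lemma mul_assoc x y z : x ∈ A -> y ∈ A -> z ∈ A ->
  app2 m (app2 m x y) z = app2 m x (app2 m y z).
Proof.
  intros Hx Hy Hz. destruct HG as [_ [K _]].
  assert (E : rel2 m x (app2 m y z) (app2 m (app2 m x y) z)).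
  { apply (K x y z (app2 m x y)); apply mul_rel; auto using mul_in. }
  now apply mul_rel in E.
Qed.

Lemma mul_inverse x : x ∈ A ->
  exists y, y ∈ A /\ app2 m x y = unit A m /\ app2 m y x = unit A m.
Proof.
  intros Hx. destruct HG as [_ [_ [e [He K]]]]. apply neutral_iff in He. subst e.
  destruct (K x Hx) as [y [Hy [K1 K2]]]. apply mul_rel in K1 as [_ [_ K1]].
  apply mul_rel in K2 as [_ [_ K2]]. now exists y.
Qed.

End Groups.

#[export] Hint Resolve Def3_neutral Trm2_unit : defn.

(** * Additive and order arithmetic of the real field *)

Section Reals.
Context {M : structure} {HZF : ZF M} (R : field_data M) (HR : complete_ordered_field R).

Definition add (x y : M) : M := app2 (R_add R) x y.
Definition le (x y : M) : Prop := rel (R_le R) x y.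
Definition real_zero : M := unit (R_set R) (R_add R).
(** An eighth of a length is avoided by multiplying out: [oct x ≤ y] says x ≤ y/8 using addition
    only. The factor comes from [limit_toggle], where a positive length is bounded by four such
    eighths, hence by half of itself. *)
Definition oct (x : M) : M := add (add (add x x) (add x x)) (add (add x x) (add x x)).

Notation "'ℝ'" := (R_set R).
Infix "⊕" := add (at level 50, left associativity).
Infix "≤" := le (at level 70).

Lemma Def2_le : Def2 le.
Proof. unfold le. def. Qed.
Lemma Trm2_add : Trm2 add.
Proof. unfold add. def. Qed.
#[local] Hint Resolve Trm2_add : defn.
Lemma Trm1_oct : Trm1 oct.
Proof. unfold oct. def. Qed.

Let HG : group ℝ (R_add R) := cof_add_group R HR.

Lemma add_rel x y z : rel2 (R_add R) x y z <-> x ∈ ℝ /\ y ∈ ℝ /\ z = x ⊕ y.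
Proof. apply (mul_rel HG). Qed.

Lemma add_in x y : x ∈ ℝ -> y ∈ ℝ -> x ⊕ y ∈ ℝ.
Proof. apply (mul_in HG). Qed.
#[local] Hint Resolve add_in : core.

Lemma zero_in : real_zero ∈ ℝ.
Proof. apply (unit_in HG). Qed.
#[local] Hint Resolve zero_in : core.

Lemma zero_neutral o : neutral ℝ (R_add R) o <-> o = real_zero.
Proof. apply (neutral_iff HG). Qed.

Lemma add_assoc x y z : x ∈ ℝ -> y ∈ ℝ -> z ∈ ℝ -> x ⊕ y ⊕ z = x ⊕ (y ⊕ z).
Proof. apply (mul_assoc HG). Qed.

Lemma add_comm x y : x ∈ ℝ -> y ∈ ℝ -> x ⊕ y = y ⊕ x.
Proof.
  intros Hx Hy. assert (H : rel2 (R_add R) y x (x ⊕ y)).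
  { apply (cof_add_comm R HR). now apply add_rel. }
  now apply add_rel in H.
Qed.

Lemma add_0l x : x ∈ ℝ -> real_zero ⊕ x = x.
Proof. apply (mul_1l HG). Qed.

Lemma add_0r x : x ∈ ℝ -> x ⊕ real_zero = x.
Proof. apply (mul_1r HG). Qed.

Lemma le_trans y x z : x ≤ y -> y ≤ z -> x ≤ z.
Proof. apply (cof_le_trans R HR). Qed.

Lemma le_refl x : x ∈ ℝ -> x ≤ x.
Proof. intros Hx. destruct (cof_le_total R HR x x Hx Hx); assumption. Qed.

Lemma le_or x y : x ∈ ℝ -> y ∈ ℝ -> x ≤ y \/ y ≤ x.
Proof. apply (cof_le_total R HR). Qed.

Lemma not_le x y : x ∈ ℝ -> y ∈ ℝ -> ~ x ≤ y -> y ≤ x.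
Proof. intros Hx Hy N. destruct (le_or x y Hx Hy); tauto. Qed.

Lemma le_in x y : x ≤ y -> x ∈ ℝ /\ y ∈ ℝ.
Proof.
  intros [p [Hp H]]. apply is_pair_iff in Hp. subst p.
  destruct (cof_le_rel R HR _ H) as [a [b [Ha [Hb E]]]]. apply is_pair_iff in E.
  apply pair_inj in E as [-> ->]. auto.
Qed.

Lemma le_add_r z x y : z ∈ ℝ -> x ≤ y -> x ⊕ z ≤ y ⊕ z.
Proof.
  intros Hz H. destruct (le_in _ _ H) as [Hx Hy].
  apply (cof_le_add R HR x y z); [exact H| |]; now apply add_rel.
Qed.

Lemma le_add x y x' y' : x ≤ y -> x' ≤ y' -> x ⊕ x' ≤ y ⊕ y'.
Proof.
  intros H K. destruct (le_in _ _ H), (le_in _ _ K).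
  apply (le_trans (y ⊕ x')); [now apply le_add_r|].
  rewrite (add_comm y x'), (add_comm y y') by trivial. now apply le_add_r.
Qed.

Lemma add_cancel x y z : x ∈ ℝ -> y ∈ ℝ -> z ∈ ℝ -> x ⊕ z ≤ y ⊕ z -> x ≤ y.
Proof.
  intros Hx Hy Hz H. destruct (mul_inverse HG z Hz) as [n [Hn [E _]]].
  apply (le_add_r n) in H; [|exact Hn].
  rewrite !add_assoc in H by trivial. change (app2 (R_add R) z n) with (z ⊕ n) in E.
  rewrite E in H. fold real_zero in H. now rewrite !add_0r in H.
Qed.

Lemma add_swap a b c d : a ∈ ℝ -> b ∈ ℝ -> c ∈ ℝ -> d ∈ ℝ ->
  (a ⊕ b) ⊕ (c ⊕ d) = (a ⊕ c) ⊕ (b ⊕ d).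
Proof.
  intros Ha Hb Hc Hd. rewrite !add_assoc by auto. f_equal.
  rewrite <- !add_assoc by auto. now rewrite (add_comm b c).
Qed.

Lemma oct_in x : x ∈ ℝ -> oct x ∈ ℝ.
Proof. unfold oct. auto 10. Qed.
#[local] Hint Resolve oct_in : core.

Lemma oct_add x y : x ∈ ℝ -> y ∈ ℝ -> oct (x ⊕ y) = oct x ⊕ oct y.
Proof.
  intros Hx Hy. unfold oct. rewrite (add_swap x y x y) by auto.
  rewrite (add_swap (x ⊕ x) (y ⊕ y) (x ⊕ x) (y ⊕ y)) by auto.
  now rewrite (add_swap (x ⊕ x ⊕ (x ⊕ x))) by auto.
Qed.

Lemma oct_le x y : x ≤ y -> oct x ≤ oct y.
Proof. intros H. unfold oct. auto 10 using le_add. Qed.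

Lemma oct_zero : oct real_zero = real_zero.
Proof. unfold oct. now rewrite !add_0r by auto. Qed.

Lemma le_double x : real_zero ≤ x -> x ≤ x ⊕ x.
Proof.
  intros H. destruct (le_in _ _ H) as [_ Hx].
  rewrite <- (add_0l x Hx) at 1. now apply le_add_r.
Qed.

Lemma le_oct x : real_zero ≤ x -> x ≤ oct x.
Proof.
  intros H. assert (K : forall y, real_zero ≤ y -> real_zero ≤ y ⊕ y).
  { intros y Hy. apply (le_trans y); [exact Hy|now apply le_double]. }
  apply (le_trans (x ⊕ x)); [now apply le_double|].
  apply (le_trans (x ⊕ x ⊕ (x ⊕ x))); apply le_double; auto.
Qed.

(** Cancelling 4x from 8x ≤ 4x leaves 4x ≤ 0. Halving this twice is [K]: a positive y would be at
    most y + y. *)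
Lemma oct_le_quad x : x ∈ ℝ -> oct x ≤ (x ⊕ x) ⊕ (x ⊕ x) -> x ≤ real_zero.
Proof.
  intros Hx H. apply NNPP. intros N.
  assert (K : forall y, y ∈ ℝ -> y ⊕ y ≤ real_zero -> y ≤ real_zero).
  { intros y Hy Hyy. apply NNPP. intros Ny. apply Ny.
    apply (le_trans (y ⊕ y)); [|exact Hyy]. apply le_double, not_le; auto. }
  apply N, K, K; auto.
  apply (add_cancel _ _ ((x ⊕ x) ⊕ (x ⊕ x))); auto.
  now rewrite add_0l by auto.
Qed.

(** The Archimedean argument: if [S] were bounded with supremum b, then b - c would be an upper
    bound as well. In the proof [n] is the negative of [c]. *)
Lemma unbounded_of_doubling (S : M) : subset S ℝ ->
  (exists c, c ∈ S /\ ~ c ≤ real_zero /\ forall x, x ∈ S -> exists y, y ∈ S /\ x ⊕ c ≤ y) ->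
  forall b, b ∈ ℝ -> exists x, x ∈ S /\ ~ x ≤ b.
Proof.
  intros HS [c [Hc [Hpos H]]] b0 Hb0. apply NNPP. intros N.
  pose proof (HS c Hc) as Hc'.
  destruct (cof_complete R HR S HS (ex_intro _ c Hc)) as [b [[Hb Hub] Hleast]].
  { exists b0. split; [exact Hb0|]. intros x Hx. apply NNPP. intros N'. eauto. }
  destruct (mul_inverse HG c Hc') as [n [Hn [E _]]].
  change (c ⊕ n = real_zero) in E.
  assert (K : upper_bound R S (b ⊕ n)).
  { split; [now apply add_in|]. intros x Hx. pose proof (HS x Hx) as Hx'.
    destruct (H x Hx) as [y [Hy Hxy]].
    apply (add_cancel _ _ c); auto.
    rewrite (add_assoc b n c), (add_comm n c), E, add_0r by auto.
    exact (le_trans _ _ _ Hxy (Hub y Hy)). }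
  apply Hleast in K. apply Hpos. apply (add_cancel _ _ (b ⊕ n)); auto.
  rewrite add_0l by auto. rewrite (add_comm c), add_assoc, (add_comm n c), E, add_0r by auto.
  exact K.
Qed.

End Reals.

(** * Isometric actions *)

#[export] Hint Resolve Def2_le Trm2_add Trm1_oct : defn.

Existing Class complete_ordered_field.

Section Length.
Context {M : structure} {HZF : ZF M} {R : field_data M} {HR : complete_ordered_field R}.
Context {G m X d a o : M} (HG : group G m) (HX : metric_space R X d)
  (Ha : isometric_action G m X d a) (Ho : o ∈ X).

Notation "'ℝ'" := (R_set R).
Notation "x ⊕ y" := (add R x y) (at level 50, left associativity).
Notation "x ≤ y" := (le R x y) (at level 70).
Notation "g · x" := (app2 a g x) (at level 40, left associativity).
Notation "g ∗ h" := (app2 m g h) (at level 40, left associativity).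

Lemma act_rel g x y : rel2 a g x y <-> g ∈ G /\ x ∈ X /\ y = g · x.
Proof. exact (is_fun2_rel a G X X (act_fun _ _ _ _ _ Ha) g x y). Qed.

Lemma act_in g x : g ∈ G -> x ∈ X -> g · x ∈ X.
Proof. exact (app2_in a G X X g x (act_fun _ _ _ _ _ Ha)). Qed.

Lemma act_unit x : x ∈ X -> unit G m · x = x.
Proof.
  intros Hx. symmetry. apply act_rel, (act_one _ _ _ _ _ Ha); [|exact Hx].
  now apply (neutral_iff HG).
Qed.

Lemma act_comp g h x : g ∈ G -> h ∈ G -> x ∈ X -> (g ∗ h) · x = g · (h · x).
Proof.
  intros Hg Hh Hx. symmetry. apply act_rel.
  apply (act_mul _ _ _ _ _ Ha g h _ x (h · x)); rewrite ?act_rel, ?(mul_rel HG);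
  auto using act_in.
Qed.

Lemma dist_rel x y r : rel2 d x y r <-> x ∈ X /\ y ∈ X /\ r = app2 d x y.
Proof. exact (is_fun2_rel d X X ℝ (dist_fun _ _ _ HX) x y r). Qed.

Lemma dist_in x y : x ∈ X -> y ∈ X -> app2 d x y ∈ ℝ.
Proof. exact (app2_in d X X ℝ x y (dist_fun _ _ _ HX)). Qed.

Let G_mul_in := mul_in HG.
Let G_unit_in := unit_in HG.
#[local] Hint Resolve act_in dist_in G_mul_in G_unit_in : core.

Lemma dist_comm x y : x ∈ X -> y ∈ X -> app2 d x y = app2 d y x.
Proof.
  intros Hx Hy. apply (proj1 (dist_rel y x _)). apply (dist_sym _ _ _ HX).
  now apply dist_rel.
Qed.

Lemma dist_tri x y z : x ∈ X -> y ∈ X -> z ∈ X -> app2 d x z ≤ app2 d x y ⊕ app2 d y z.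
Proof.
  intros Hx Hy Hz. apply (dist_triangle _ _ _ HX x y z (app2 d x y) (app2 d y z));
  rewrite ?dist_rel, ?(add_rel R HR); auto.
Qed.

Lemma dist_nonneg x y : x ∈ X -> y ∈ X -> real_zero R ≤ app2 d x y.
Proof.
  intros Hx Hy. apply (dist_ge0 _ _ _ HX _ x y); [now apply (zero_neutral R HR)|].
  now apply dist_rel.
Qed.

Lemma dist_self x : x ∈ X -> app2 d x x = real_zero R.
Proof.
  intros Hx. apply (dist_eq0 _ _ _ HX _ x x); [now apply (zero_neutral R HR)| |reflexivity].
  now apply dist_rel.
Qed.

Lemma dist_act g x y : g ∈ G -> x ∈ X -> y ∈ X -> app2 d (g · x) (g · y) = app2 d x y.
Proof.
  intros Hg Hx Hy. symmetry. apply dist_rel.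
  apply (act_isometry _ _ _ _ _ Ha g x y); rewrite ?act_rel, ?dist_rel; auto.
Qed.

Definition len (g : M) : M := app2 d o (g · o).
Notation L := len.

Lemma Trm1_len : Trm1 L.
Proof. unfold len. def. Qed.

Lemma len_in g : g ∈ G -> L g ∈ ℝ.
Proof. intros Hg. unfold len. auto. Qed.

Lemma len_nonneg g : g ∈ G -> real_zero R ≤ L g.
Proof. intros Hg. apply dist_nonneg; auto. Qed.

Lemma len_unit : L (unit G m) = real_zero R.
Proof. unfold len. rewrite act_unit by exact Ho. now apply dist_self. Qed.

#[local] Hint Resolve len_in add_in : core.

Lemma len_mul g h : g ∈ G -> h ∈ G -> L (g ∗ h) ≤ L g ⊕ L h.
Proof.
  intros Hg Hh. unfold len. rewrite act_comp by trivial.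
  rewrite <- (dist_act g o (h · o)) by auto. apply dist_tri; auto.
Qed.

Lemma dist_orbit g h : g ∈ G -> h ∈ G -> app2 d (g · o) (h · o) ≤ L g ⊕ L h.
Proof.
  intros Hg Hh. unfold len. rewrite (dist_comm o (g · o)) by auto. apply dist_tri; auto.
Qed.

(** The triangle inequality through w·v·o. The distance from w·v·o to w·o equals [L v] by isometry,
    so no inverse of [v] enters. *)
Lemma len_left w v : w ∈ G -> v ∈ G -> L w ≤ L (w ∗ v) ⊕ L v.
Proof.
  intros Hw Hv. unfold len at 3. rewrite <- (dist_act w) by auto.
  rewrite (dist_comm (w · o)), <- (act_comp w v) by auto. apply dist_tri; auto.
Qed.

(** A conjugate [w] of [g] by [u] is compared with [g] along the points
    u·o, o, w·o and w·u·o. *)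
Lemma len_conj g u w v : g ∈ G -> u ∈ G -> w ∈ G -> v ∈ G -> w ∗ u = u ∗ g ->
  L g ≤ (L u ⊕ L u) ⊕ (L (w ∗ v) ⊕ L v).
Proof.
  intros Hg Hu Hw Hv E.
  assert (H : L g ≤ L u ⊕ L (w ∗ u)).
  { unfold len at 1. rewrite <- (dist_act u), <- (act_comp u g), <- E by auto.
    apply dist_orbit; auto. }
  apply (le_trans R HR _ _ _ H).
  rewrite (add_assoc R HR) by auto. apply (le_add R HR).
  - apply (le_refl R HR); auto.
  - apply (le_trans R HR (L w ⊕ L u)); [now apply len_mul|].
    rewrite (add_comm R HR) by auto. apply (le_add R HR).
    + apply (le_refl R HR); auto.
    + now apply len_left.
Qed.

Lemma bounded_orbit_of_len : (exists b, b ∈ ℝ /\ forall g, g ∈ G -> L g ≤ b) ->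
  bounded_orbit R G d a o.
Proof.
  intros [b [Hb H]]. exists (b ⊕ b). split; [now apply (add_in R HR)|].
  intros g h y z r Hg Hh Hy Hz Hr.
  apply act_rel in Hy as [_ [_ ->]]. apply act_rel in Hz as [_ [_ ->]].
  apply dist_rel in Hr as [_ [_ ->]].
  apply (le_trans R HR _ _ _ (dist_orbit g h Hg Hh)). apply (le_add R HR); auto.
Qed.

Lemma len_of_bounded_orbit : bounded_orbit R G d a o ->
  exists b, b ∈ ℝ /\ forall g, g ∈ G -> L g ≤ b.
Proof.
  intros [b [Hb H]]. exists b. split; [exact Hb|]. intros g Hg.
  apply (H (unit G m) g (unit G m · o) (g · o)); auto; rewrite ?act_rel, ?dist_rel; auto.
  rewrite act_unit; auto.
Qed.

End Length.

Arguments len {M HZF} d a o g.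

(** * Countable products of groups *)

#[export] Hint Resolve Trm1_len : defn.

Ltac def_extra ::=
  lazymatch goal with
  | |- Trm (fun e => fn _ _) => apply Trm_fn
  | |- Trm (fun e => rec _ _ _ _) => apply Trm_rec
  end.

Section ProductGroup.
Context {M : structure} {HZF : ZF M} {omega : M} {Homega : is_omega omega}.
Context {A L P m : M} (HA : fun_on A omega) (HL : fun_on L omega)
  (HGn : forall n, n ∈ omega -> group (app A n) (app L n))
  (HP : is_product_group omega A L P m).

Notation "f ∗ g" := (app2 m f g) (at level 40, left associativity).
Notation u n := (unit (app A n) (app L n)).

Lemma P_spec f : f ∈ P <-> fun_on f omega /\ forall n, n ∈ omega -> app f n ∈ app A n.
Proof.
  destruct HP as [H _]. rewrite (H f). split; intros [Hf K]; (split; [exact Hf|]).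
  - intros n Hn. apply (K n); [now apply rel_app with omega|now apply rel_app with omega].
  - intros n a x Ha Hx. apply (rel_fun A omega) in Ha as [Hn ->]; [|exact HA].
    apply (rel_fun f omega) in Hx as [_ ->]; [|exact Hf]. auto.
Qed.

Lemma P_app f n : f ∈ P -> n ∈ omega -> app f n ∈ app A n.
Proof. intros Hf. now apply P_spec. Qed.

Lemma P_ext f g : f ∈ P -> g ∈ P -> (forall n, n ∈ omega -> app f n = app g n) -> f = g.
Proof. intros Hf Hg. apply fun_ext; now apply P_spec. Qed.

Lemma P_fn F : Trm1 F -> (forall n, n ∈ omega -> F n ∈ app A n) -> fn omega F ∈ P.
Proof.
  intros D H. apply P_spec. split; [now apply fn_fun_on|].
  intros n Hn. rewrite fn_app; auto.
Qed.

Lemma P_mul_rel f g h : rel2 m f g h <-> f ∈ P /\ g ∈ P /\ h = f ∗ g.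
Proof. destruct HP as [_ [H _]]. now apply (is_fun2_rel m P P P). Qed.

Lemma P_mul_in f g : f ∈ P -> g ∈ P -> f ∗ g ∈ P.
Proof. destruct HP as [_ [H _]]. now apply (app2_in m P P P). Qed.

Lemma P_mul_app f g n : f ∈ P -> g ∈ P -> n ∈ omega ->
  app (f ∗ g) n = app2 (app L n) (app f n) (app g n).
Proof.
  intros Hf Hg Hn. destruct HP as [_ [_ H]].
  assert (K : rel2 (app L n) (app f n) (app g n) (app (f ∗ g) n)).
  { apply (H f g (f ∗ g)) with (n := n).
    - now apply P_mul_rel.
    - now apply rel_app with omega.
    - apply rel_app with omega; [now apply P_spec|exact Hn].
    - apply rel_app with omega; [now apply P_spec|exact Hn].
    - apply rel_app with omega; [now apply P_spec, P_mul_in|exact Hn]. }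
  now apply (mul_rel (HGn n Hn)) in K.
Qed.

Lemma u_in n : n ∈ omega -> u n ∈ app A n.
Proof. intros Hn. apply (unit_in (HGn n Hn)). Qed.

Lemma P_neutral : neutral P m (fn omega (fun n => u n)).
Proof.
  assert (Hu : fn omega (fun n => u n) ∈ P) by (apply P_fn; [def|apply u_in]).
  split; [exact Hu|]. intros f Hf. rewrite !P_mul_rel. repeat split; trivial;
  (apply P_ext; auto using P_mul_in; intros n Hn; rewrite P_mul_app by trivial;
   rewrite fn_app by (trivial; def); symmetry).
  - apply (mul_1l (HGn n Hn)). now apply P_app.
  - apply (mul_1r (HGn n Hn)). now apply P_app.
Qed.

Lemma P_group : group P m.
Proof.
  split; [now destruct HP as [_ [H _]]|]. split.
  - intros x y z a b c. rewrite !P_mul_rel. intros [Hx [Hy ->]] [_ [Hz ->]] [_ [_ ->]].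
    repeat split; auto using P_mul_in.
    apply P_ext; auto using P_mul_in. intros n Hn.
    rewrite !P_mul_app by auto using P_mul_in.
    apply (mul_assoc (HGn n Hn)); now apply P_app.
  - exists (fn omega (fun n => u n)). split; [exact P_neutral|]. intros x Hx.
    (* Inverses in each factor are unique, so [the] names them and the sequence of inverses exists
       by replacement, without choice. *)
    set (inv := fun n => the (fun y => y ∈ app A n /\
      app2 (app L n) (app x n) y = u n /\ app2 (app L n) y (app x n) = u n)).
    assert (Hinv : forall n, n ∈ omega -> inv n ∈ app A n /\
      app2 (app L n) (app x n) (inv n) = u n /\ app2 (app L n) (inv n) (app x n) = u n).
    { intros n Hn. pose proof (P_app x n Hx Hn) as Hxn.
      apply (the_spec (fun y => y ∈ app A n /\
        app2 (app L n) (app x n) y = u n /\ app2 (app L n) y (app x n) = u n)).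
      destruct (mul_inverse (HGn n Hn) (app x n) Hxn) as [y [Hy [E1 E2]]].
      exists y. split; [auto|]. intros z [Hz [E3 E4]].
      rewrite <- (mul_1l (HGn n Hn) z Hz), <- E2.
      now rewrite (mul_assoc (HGn n Hn)), E3, (mul_1r (HGn n Hn)). }
    assert (D : Trm1 inv) by (unfold inv; def).
    assert (Hi : fn omega inv ∈ P) by (apply P_fn; [exact D|]; intros n Hn; now apply Hinv).
    pose proof P_neutral as [Hu _].
    exists (fn omega inv). rewrite !P_mul_rel. repeat split; trivial;
    (apply P_ext; [assumption|now apply P_mul_in|]; intros n Hn;
     rewrite P_mul_app by trivial; rewrite !fn_app by (trivial; def); symmetry;
     apply (Hinv n Hn)).
Qed.

Lemma P_unit_in : unit P m ∈ P.
Proof. apply (unit_in P_group). Qed.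

Lemma P_unit_app n : n ∈ omega -> app (unit P m) n = u n.
Proof.
  intros Hn. rewrite <- (proj1 (neutral_iff P_group _) P_neutral).
  rewrite fn_app; [reflexivity|def|exact Hn].
Qed.

Definition embed (w A L n g : M) : M :=
  fn w (fun k => ite (k = n) g (unit (app A k) (app L k))).

Lemma embed_app_eq n g : n ∈ omega -> app (embed omega A L n g) n = g.
Proof. intros Hn. unfold embed. rewrite fn_app by (trivial; def). now apply ite_true. Qed.

Lemma embed_app_ne n g k : k ∈ omega -> k <> n -> app (embed omega A L n g) k = u k.
Proof. intros Hk N. unfold embed. rewrite fn_app by (trivial; def). now apply ite_false. Qed.

Lemma embed_in n g : n ∈ omega -> g ∈ app A n -> embed omega A L n g ∈ P.
Proof.
  intros Hn Hg. apply P_fn; [def|]. intros k Hk.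
  destruct (classic (k = n)) as [->|N]; [now rewrite ite_true|].
  rewrite ite_false by exact N. now apply u_in.
Qed.

Lemma embed_mul n g h : n ∈ omega -> g ∈ app A n -> h ∈ app A n ->
  embed omega A L n (app2 (app L n) g h) = embed omega A L n g ∗ embed omega A L n h.
Proof.
  intros Hn Hg Hh. pose proof (mul_in (HGn n Hn) g h Hg Hh).
  apply P_ext; auto using P_mul_in, embed_in.
  intros k Hk. rewrite P_mul_app by auto using embed_in.
  destruct (classic (k = n)) as [->|N]; [now rewrite !embed_app_eq|].
  rewrite !embed_app_ne by trivial. symmetry. apply (mul_1l (HGn k Hk)), u_in, Hk.
Qed.

Lemma embed_unit n : n ∈ omega -> embed omega A L n (u n) = unit P m.
Proof.
  intros Hn. apply P_ext; auto using embed_in, u_in, P_unit_in.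
  intros k Hk. rewrite P_unit_app by exact Hk.
  destruct (classic (k = n)) as [->|N]; [now rewrite !embed_app_eq|].
  now rewrite !embed_app_ne.
Qed.

Definition head (w A L n f : M) : M :=
  fn w (fun k => ite (k ∈ n) (app f k) (unit (app A k) (app L k))).
Definition tail (w A L n f : M) : M :=
  fn w (fun k => ite (k ∈ n) (unit (app A k) (app L k)) (app f k)).

Lemma head_app_in n f k : k ∈ omega -> k ∈ n -> app (head omega A L n f) k = app f k.
Proof. intros Hk Hn. unfold head. rewrite fn_app by (trivial; def). now apply ite_true. Qed.
Lemma head_app_out n f k : k ∈ omega -> ~ k ∈ n -> app (head omega A L n f) k = u k.
Proof. intros Hk Hn. unfold head. rewrite fn_app by (trivial; def). now apply ite_false. Qed.
Lemma tail_app_in n f k : k ∈ omega -> k ∈ n -> app (tail omega A L n f) k = u k.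
Proof. intros Hk Hn. unfold tail. rewrite fn_app by (trivial; def). now apply ite_true. Qed.
Lemma tail_app_out n f k : k ∈ omega -> ~ k ∈ n -> app (tail omega A L n f) k = app f k.
Proof. intros Hk Hn. unfold tail. rewrite fn_app by (trivial; def). now apply ite_false. Qed.

Lemma head_in n f : f ∈ P -> head omega A L n f ∈ P.
Proof.
  intros Hf. apply P_fn; [def|]. intros k Hk.
  destruct (classic (k ∈ n)) as [H|H]; [rewrite ite_true by exact H; now apply P_app|].
  rewrite ite_false by exact H. now apply u_in.
Qed.

Lemma tail_in n f : f ∈ P -> tail omega A L n f ∈ P.
Proof.
  intros Hf. apply P_fn; [def|]. intros k Hk.
  destruct (classic (k ∈ n)) as [H|H]; [rewrite ite_true by exact H; now apply u_in|].
  rewrite ite_false by exact H. now apply P_app.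
Qed.

Lemma head_mul_tail n f : f ∈ P -> head omega A L n f ∗ tail omega A L n f = f.
Proof.
  intros Hf. apply P_ext; auto using P_mul_in, head_in, tail_in.
  intros k Hk. rewrite P_mul_app by auto using head_in, tail_in.
  pose proof (P_app f k Hf Hk) as Hfk.
  destruct (classic (k ∈ n)) as [H|H].
  - rewrite head_app_in, tail_app_in by trivial. now apply (mul_1r (HGn k Hk)).
  - rewrite head_app_out, tail_app_out by trivial. now apply (mul_1l (HGn k Hk)).
Qed.

End ProductGroup.

(** * Bounded heads, unbounded tails, and a sequence of fast growing length *)

Section Tails.
Context {M : structure} {HZF : ZF M} {omega : M} {Homega : is_omega omega}.
Context {R : field_data M} {HR : complete_ordered_field R}.
Context {A L P m : M} (HA : fun_on A omega) (HL : fun_on L omega)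
  (HSB : forall n, n ∈ omega -> strongly_bounded R (app A n) (app L n))
  (HP : is_product_group omega A L P m).
Context (X d a o : M) (HX : metric_space R X d) (Ha : isometric_action P m X d a)
  (Ho : o ∈ X).

Notation "f ∗ g" := (app2 m f g) (at level 40, left associativity).
Notation u n := (unit (app A n) (app L n)).
Notation "'ℝ'" := (R_set R).
Notation "x ⊕ y" := (add R x y) (at level 50, left associativity).
Notation "x ≤ y" := (le R x y) (at level 70).
Notation len := (len d a o).

Let HGn n (Hn : n ∈ omega) : group (app A n) (app L n) := proj1 (HSB n Hn).
Let HG : group P m := P_group HA HL HGn HP.

Let Pmul_in f g : f ∈ P -> g ∈ P -> f ∗ g ∈ P := mul_in HG f g.
Let Plen_in g : g ∈ P -> len g ∈ ℝ := len_in HX Ha Ho g.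
Let Punit_in : unit P m ∈ P := unit_in HG.
Let Papp := P_app HA HP.
Let Pext := P_ext HA HP.
Let Pfn := P_fn HA HP.
Let Pmul_app := P_mul_app HA HL HGn HP.
Let Punit_app := P_unit_app HA HL HGn HP.
Let Pembed_in := embed_in HA HGn HP.
Let Phead_in := head_in HA HGn HP.
Let Ptail_in := tail_in HA HGn HP.
#[local] Hint Resolve Pmul_in Plen_in Punit_in Pembed_in Phead_in Ptail_in add_in zero_in
  oct_in : core.

(** The [n]-th factor acts isometrically on the same space [X] through its embedding into [P], so
    its strong boundedness applies to this action. *)
Lemma embed_bounded n : n ∈ omega ->
  exists b, b ∈ ℝ /\ forall g, g ∈ app A n -> len (embed omega A L n g) ≤ b.
Proof.
  intros Hn. set (an := fn2 (app A n) X (fun g x => app2 a (embed omega A L n g) x)).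
  assert (D : Trm2 (fun g x => app2 a (embed omega A L n g) x)) by (unfold embed; def).
  assert (Hin : forall g, g ∈ app A n -> embed omega A L n g ∈ P)
    by (intros g; now apply Pembed_in).
  assert (Hr : forall g x y, rel2 an g x y <->
    g ∈ app A n /\ x ∈ X /\ y = app2 a (embed omega A L n g) x)
    by (intros g x y; exact (fn2_rel _ _ _ g x y D)).
  assert (Han : isometric_action (app A n) (app L n) X d an).
  { split.
    - apply fn2_is_fun2; [exact D|]. intros g x Hg Hx. apply (act_in Ha); auto.
    - intros e x He Hx. apply (neutral_iff (HGn n Hn)) in He. subst e. apply Hr.
      split; [now apply (unit_in (HGn n Hn))|]. split; [exact Hx|].
      rewrite (embed_unit HA HL HGn HP) by exact Hn. symmetry. now apply (act_unit HG Ha).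
    - intros g h k x y z. rewrite (mul_rel (HGn n Hn)), !Hr.
      intros [Hg [Hh ->]] [_ [Hx ->]] [_ [Hy ->]].
      split; [now apply (mul_in (HGn n Hn))|]. split; [exact Hx|].
      rewrite (embed_mul HA HL HGn HP) by trivial. symmetry.
      apply (act_comp HG Ha); auto.
    - intros g x y x' y' r. rewrite !Hr, !(dist_rel HX).
      intros [Hg [Hx ->]] [_ [Hy ->]] [_ [_ ->]].
      repeat split; try (apply (act_in Ha); auto). symmetry. apply (dist_act HX Ha); auto. }
  destruct (HSB n Hn) as [_ K]. specialize (K X d an HX Han o Ho).
  destruct (len_of_bounded_orbit (HGn n Hn) HX Han Ho K) as [b [Hb Hbound]].
  exists b. split; [exact Hb|]. intros g Hg.
  specialize (Hbound g Hg). unfold len in *.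
  now rewrite <- (proj2 (proj2 (proj1 (Hr g o _) (proj2 (act_rel Han g o _)
    (conj Hg (conj Ho eq_refl)))))).
Qed.

Definition vanish (w A L n f : M) : Prop :=
  forall k, k ∈ w -> k ∈ n -> app f k = unit (app A k) (app L k).

Definition supported (w A L n f : M) : Prop :=
  forall k, k ∈ w -> ~ k ∈ n -> app f k = unit (app A k) (app L k).

(** The induction splits off the last coordinate as an embedded factor. Only the existence of a
    bound is carried along, so the bounds for the factors are never chosen simultaneously. *)
Lemma supported_bounded n : n ∈ omega ->
  exists b, b ∈ ℝ /\ forall f, f ∈ P -> supported omega A L n f -> len f ≤ b.
Proof.
  revert n. apply (omega_ind (fun n => exists b, b ∈ ℝ /\
    forall f, f ∈ P -> supported omega A L n f -> len f ≤ b)); [unfold supported; def| |].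
  - exists (real_zero R). split; [now apply zero_in|]. intros f Hf H.
    replace f with (unit P m).
    + rewrite (len_unit HG HX Ha Ho). now apply (le_refl R HR), zero_in.
    + apply Pext; trivial. intros k Hk. rewrite Punit_app by exact Hk.
      symmetry. apply H; [exact Hk|apply emp_spec].
  - intros n Hn [b [Hb IH]]. destruct (embed_bounded n Hn) as [c [Hc K]].
    exists (b ⊕ c). split; [now apply (add_in R HR)|]. intros f Hf Hs.
    pose proof (Papp f n Hf Hn) as Hfn.
    replace f with (head omega A L n f ∗ embed omega A L n (app f n)).
    { apply (le_trans R HR (len (head omega A L n f) ⊕ len (embed omega A L n (app f n)))).
      - apply (len_mul HG HX Ha Ho); auto.
      - apply (le_add R HR); [|now apply K]. apply IH; [auto|].
        intros k Hk Nk. now apply head_app_out. }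
    apply Pext; auto. intros k Hk. rewrite Pmul_app by auto.
    pose proof (Papp f k Hf Hk) as Hfk.
    destruct (classic (k ∈ n)) as [H|H].
    + rewrite head_app_in, embed_app_ne; trivial; [now apply (mul_1r (HGn k Hk))|].
      intros ->. now apply not_in_self in H.
    + rewrite head_app_out by trivial. destruct (classic (k = n)) as [->|N].
      * rewrite embed_app_eq by trivial. now apply (mul_1l (HGn n Hn)).
      * rewrite embed_app_ne by trivial. rewrite Hs; trivial.
        -- apply (mul_1l (HGn k Hk)), (unit_in (HGn k Hk)).
        -- rewrite succ_spec. tauto.
Qed.

Context (Hunb : ~ exists b, b ∈ ℝ /\ forall g, g ∈ P -> len g ≤ b).

Lemma tail_unbounded n b : n ∈ omega -> b ∈ ℝ ->
  exists g, g ∈ P /\ vanish omega A L n g /\ ~ len g ≤ b.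
Proof.
  intros Hn Hb. apply NNPP. intros N. apply Hunb.
  destruct (supported_bounded n Hn) as [c [Hc K]].
  exists (c ⊕ b). split; [now apply (add_in R HR)|]. intros f Hf.
  rewrite <- (head_mul_tail HA HL HGn HP n f Hf).
  apply (le_trans R HR (len (head omega A L n f) ⊕ len (tail omega A L n f))).
  - apply (len_mul HG HX Ha Ho); auto.
  - apply (le_add R HR).
    + apply K; [auto|]. intros k Hk Nk. now apply head_app_out.
    + apply NNPP. intros N'. apply N. exists (tail omega A L n f).
      repeat split; auto. intros k Hk Hkn. now apply tail_app_in.
Qed.

Lemma len_nonneg_P g : g ∈ P -> real_zero R ≤ len g.
Proof. apply (len_nonneg HX Ha Ho). Qed.
#[local] Hint Resolve len_nonneg_P : core.

Context (HDC : DC omega).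

Lemma growing_sequence : exists s,
  (forall n, n ∈ omega -> app s n ∈ P /\ ~ len (app s n) ≤ real_zero R /\
     vanish omega A L n (app s n)) /\
  forall n, n ∈ omega ->
    oct R (len (app s n)) ⊕ oct R (len (app s n)) ≤ len (app s (succ n)).
Proof.
  (* DC does not see the stage, so the number of trivial coordinates is handled by quantification:
     whenever [g] is trivial below some [n], [h] is trivial one coordinate further. The growth
     factor 16 is explained at [partial_len]. *)
  set (Q := fun g h => (forall n, n ∈ omega -> vanish omega A L n g ->
      vanish omega A L (succ n) h) /\ oct R (len g) ⊕ oct R (len g) ≤ len h).
  assert (D : Def2 Q) by (unfold Q, vanish; def).
  set (Z := compr P (fun g => ~ len g ≤ real_zero R)).
  assert (HZ : forall g, g ∈ Z <-> g ∈ P /\ ~ len g ≤ real_zero R)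
    by (intros g; unfold Z; now rewrite compr_spec by def).
  destruct (dependent_choice HDC Z Q D) as [s [Hs HQ]].
  - destruct (tail_unbounded emp (real_zero R)) as [g [Hg [_ K]]]; auto.
    exists g. now apply HZ.
  - intros g Hg. apply HZ in Hg as [Hg Hpos].
    (* Positive length makes [g] differ from the unit at some [k]. Every [n] below which [g] is
       trivial then satisfies n ≤ k, so an [h] trivial below [succ k] serves all these [n] at
       once. *)
    assert (exists k, k ∈ omega /\ app g k <> u k) as [k [Hk Nk]].
    { apply NNPP. intros N. apply Hpos. replace g with (unit P m).
      - rewrite (len_unit HG HX Ha Ho). apply (le_refl R HR); auto.
      - apply Pext; trivial. intros k Hk. rewrite Punit_app by exact Hk.
        apply NNPP. intros N'. apply N. exists k. auto. }
    destruct (tail_unbounded (succ k) (oct R (len g) ⊕ oct R (len g))) as [h [Hh [Hv K]]]; auto.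
    assert (H0 : real_zero R ≤ oct R (len g) ⊕ oct R (len g)).
    { apply (le_trans R HR (len g)); auto. apply (le_trans R HR (oct R (len g))).
      - apply (le_oct R HR); auto.
      - apply (le_double R HR). apply (le_trans R HR (len g)); auto. apply (le_oct R HR); auto. }
    exists h. split.
    + apply HZ. split; [exact Hh|]. intros K'. apply K.
      exact (le_trans R HR _ _ _ K' H0).
    + split; [|apply (not_le R HR); auto].
      intros n Hn Hgn j Hj Hjn. apply Hv; [exact Hj|].
      destruct (nat_le_lt n k Hn Hk) as [E|E]; [|now destruct Nk; apply Hgn].
      apply (nat_lt_le_trans _ (succ n)); auto. apply succ_in_succ; auto.
  - exists s. split; [|intros n Hn; now apply HQ].
    assert (HsP : forall n, n ∈ omega -> app s n ∈ P /\ ~ len (app s n) ≤ real_zero R)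
      by (intros n Hn; now apply HZ, Hs).
    intros n Hn. destruct (HsP n Hn) as [H1 H2]. repeat split; trivial.
    revert n Hn H1 H2.
    apply (omega_ind (fun n => app s n ∈ P -> ~ len (app s n) ≤ real_zero R ->
      vanish omega A L n (app s n))); [unfold vanish; def| |].
    + intros _ _ k Hk Hk'. now apply emp_spec in Hk'.
    + intros n Hn IH _ _. apply (proj1 (HQ n Hn) n Hn). apply IH; now apply HsP.
Qed.

(** * Ordered infinite products over subsets of [omega] *)

Section Contradiction.
Context (s : M)
  (HsP : forall n, n ∈ omega -> app s n ∈ P)
  (Hspos : forall n, n ∈ omega -> ~ len (app s n) ≤ real_zero R)
  (Hsv : forall n, n ∈ omega -> vanish omega A L n (app s n))
  (Hsgrow : forall n, n ∈ omega ->
    oct R (len (app s n)) ⊕ oct R (len (app s n)) ≤ len (app s (succ n))).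
#[local] Hint Resolve HsP : core.

Lemma len_step n : n ∈ omega -> len (app s n) ⊕ len (app s n) ≤ len (app s (succ n)).
Proof.
  intros Hn. apply (le_trans R HR _ _ _) with (2 := Hsgrow n Hn).
  apply (le_add R HR); apply (le_oct R HR); auto.
Qed.

Lemma len_mono m' n : n ∈ omega -> m' ∈ succ n -> len (app s m') ≤ len (app s n).
Proof.
  intros Hn. revert n Hn m'. apply (omega_ind (fun n => forall m', m' ∈ succ n ->
    len (app s m') ≤ len (app s n))); [def| |].
  - intros k Hk. apply succ_spec in Hk as [Hk| ->]; [now apply emp_spec in Hk|].
    apply (le_refl R HR); auto.
  - intros n Hn IH k Hk. apply succ_spec in Hk as [Hk| ->]; [|apply (le_refl R HR); auto].
    apply (le_trans R HR _ _ _ (IH k Hk)).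
    apply (le_trans R HR _ _ _) with (2 := len_step n Hn).
    apply (le_double R HR); auto.
Qed.

Lemma len_unbounded b n : b ∈ ℝ -> n ∈ omega ->
  exists j, j ∈ omega /\ n ∈ succ j /\ ~ len (app s j) ≤ b.
Proof.
  intros Hb Hn.
  set (S := repl omega (fun k => len (app s k))).
  assert (HS : forall x, x ∈ S <-> exists k, k ∈ omega /\ x = len (app s k))
    by (intros x; unfold S; now rewrite repl_spec by def).
  destruct (unbounded_of_doubling R HR S) with (b := b) as [x [Hx Nx]]; trivial.
  - intros x Hx. apply HS in Hx as [k [Hk ->]]. auto.
  (* The increment is the first length: each step at least doubles the length, and by monotonicity
     the current one is at least the first. *)
  - exists (len (app s emp)). split.
    { apply HS. exists emp. split; [apply omega_emp|reflexivity]. }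
    split; [auto|].
    intros x Hx. apply HS in Hx as [k [Hk ->]].
    exists (len (app s (succ k))). split.
    { apply HS. exists (succ k). split; [now apply omega_succ|reflexivity]. }
    apply (le_trans R HR _ _ _) with (2 := len_step k Hk).
    apply (le_add R HR); [apply (le_refl R HR); auto|].
    apply len_mono; [exact Hk|now apply emp_in_succ].
  - apply HS in Hx as [k [Hk ->]].
    destruct (nat_le_lt n k Hn Hk) as [H|H]; [now exists k|].
    exists n. split; [exact Hn|]. split; [apply in_succ|]. intros K. apply Nx.
    apply (le_trans R HR _ _ _) with (2 := K). apply len_mono; auto.
Qed.

(** [partial S n] is the product of the [s i], i ∈ S, i < n, in increasing
    order.  As [s i] is trivial below [i], these products converge
    coordinatewise to [limit S]. *)
Definition partial (S n : M) : M :=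
  rec omega (unit P m) (fun k v => ite (k ∈ S) (v ∗ app s k) v) n.

Definition limit (S : M) : M := fn omega (fun k => app (partial S (succ k)) k).

Lemma Trm2_partial : Trm2 partial.
Proof. unfold partial. def. Qed.
#[local] Hint Resolve Trm2_partial : defn.

Lemma Trm1_limit : Trm1 limit.
Proof. unfold limit. def. Qed.
#[local] Hint Resolve Trm1_limit : defn.

Lemma partial_closed S k v : k ∈ omega -> v ∈ P -> ite (k ∈ S) (v ∗ app s k) v ∈ P.
Proof.
  intros Hk Hv. destruct (classic (k ∈ S)) as [H|H];
  [rewrite ite_true by exact H|rewrite ite_false by exact H]; auto.
Qed.

Lemma partial_emp S : partial S emp = unit P m.
Proof. apply (rec_emp P); [def|auto|apply partial_closed]. Qed.

Lemma partial_succ S n : n ∈ omega ->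
  partial S (succ n) = ite (n ∈ S) (partial S n ∗ app s n) (partial S n).
Proof.
  intros Hn. unfold partial.
  apply (rec_succ P _ (fun k v => ite (k ∈ S) (v ∗ app s k) v));
  [def|auto|apply partial_closed|exact Hn].
Qed.

Lemma partial_succ_in S n : n ∈ omega -> n ∈ S -> partial S (succ n) = partial S n ∗ app s n.
Proof. intros Hn HS. rewrite partial_succ by exact Hn. now apply ite_true. Qed.

Lemma partial_succ_out S n : n ∈ omega -> ~ n ∈ S -> partial S (succ n) = partial S n.
Proof. intros Hn HS. rewrite partial_succ by exact Hn. now apply ite_false. Qed.

Lemma partial_in S n : n ∈ omega -> partial S n ∈ P.
Proof. apply (rec_in P); [def|auto|apply partial_closed]. Qed.
#[local] Hint Resolve partial_in : core.

Lemma limit_in S : limit S ∈ P.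
Proof. apply Pfn; [def|]. intros k Hk. auto. Qed.
#[local] Hint Resolve limit_in : core.

Lemma partial_limit S n k : n ∈ omega -> k ∈ n -> app (partial S n) k = app (limit S) k.
Proof.
  intros Hn. revert n Hn k.
  apply (omega_ind (fun n => forall k, k ∈ n -> app (partial S n) k = app (limit S) k));
    [def| |].
  - intros k Hk. now apply emp_spec in Hk.
  - intros n Hn IH k Hk. assert (Hko : k ∈ omega) by (apply (omega_trans _ _ Hk); auto).
    apply succ_spec in Hk as [Hk| ->].
    + rewrite <- (IH k Hk). destruct (classic (n ∈ S)) as [H|H].
      * rewrite partial_succ_in, Pmul_app, (Hsv n Hn k Hko Hk) by auto.
        apply (mul_1r (HGn k Hko)). auto.
      * now rewrite partial_succ_out.
    + unfold limit. rewrite fn_app; [reflexivity|def|exact Hn].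
Qed.

(** The factor 16 in the growth is 8 + 8. In 8·len of the next partial product, one part 8·len (s n)
    pays for the new factor; the other pays for the old product, since 8·len (partial S n) ≤ len (s
    n) ≤ 8·len (s n). *)
Lemma partial_len S n : n ∈ omega -> oct R (len (partial S n)) ≤ len (app s n).
Proof.
  revert n. apply (omega_ind (fun n => oct R (len (partial S n)) ≤ len (app s n))); [def| |].
  - rewrite partial_emp, (len_unit HG HX Ha Ho), (oct_zero R HR). auto.
  - intros n Hn IH. apply (le_trans R HR _ _ _) with (2 := Hsgrow n Hn).
    assert (H : len (app s n) ≤ oct R (len (app s n))) by (apply (le_oct R HR); auto).
    assert (K : oct R (len (partial S n)) ≤ oct R (len (app s n)))
      by exact (le_trans R HR _ _ _ IH H).
    destruct (classic (n ∈ S)) as [E|E].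
    + rewrite partial_succ_in by trivial.
      apply (le_trans R HR (oct R (len (partial S n) ⊕ len (app s n)))).
      * apply (oct_le R HR), (len_mul HG HX Ha Ho); auto.
      * rewrite (oct_add R HR) by auto. apply (le_add R HR); [exact K|].
        apply (le_refl R HR); auto.
    + rewrite partial_succ_out by trivial.
      apply (le_trans R HR _ _ _ K). apply (le_double R HR).
      apply (le_trans R HR _ _ _) with (2 := H); auto.
Qed.

Lemma limit_toggle S T j : j ∈ omega -> j ∈ S -> ~ j ∈ T ->
  (forall k, k ∈ omega -> k <> j -> (k ∈ S <-> k ∈ T)) ->
  oct R (len (limit S)) ≤ len (app s j) -> ~ oct R (len (limit T)) ≤ len (app s j).
Proof.
  intros Hj HjS HjT HST H1 H2.
  assert (Eq : forall n, n ∈ omega -> n ∈ succ j -> partial S n = partial T n).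
  { apply (omega_ind (fun n => n ∈ succ j -> partial S n = partial T n)); [def| |].
    - now rewrite !partial_emp.
    - intros n Hn IH Hnj.
      assert (Hlt : n ∈ j) by (apply (nat_lt_le_trans _ (succ n)); auto).
      specialize (IH (in_succ_of _ _ Hlt)).
      assert (n <> j) by (intros ->; now apply not_in_self in Hlt).
      specialize (HST n Hn H). destruct (classic (n ∈ S)) as [E|E].
      + rewrite !partial_succ_in by tauto. now rewrite IH.
      + rewrite !partial_succ_out by tauto. exact IH. }
  set (x := partial S j). assert (Hx : x ∈ P) by (unfold x; auto).
  destruct (mul_inverse HG x Hx) as [y [Hy [_ Eyx]]].
  (* The conjugate moves the extra factor [s j] to the left of the common prefix [x]. There it stays
     in front while later common factors are multiplied on the right, so the identity passes to the
     limits. *)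
  set (w := x ∗ app s j ∗ y). assert (Hw : w ∈ P) by (unfold w; auto).
  assert (Ew : w ∗ x = x ∗ app s j).
  { unfold w. rewrite (mul_assoc HG) by auto. rewrite Eyx. apply (mul_1r HG); auto. }
  assert (Hpart : forall n, n ∈ omega -> j ∈ n -> partial S n = w ∗ partial T n).
  { apply (omega_ind (fun n => j ∈ n -> partial S n = w ∗ partial T n)); [def| |].
    - intros K. now apply emp_spec in K.
    - intros n Hn IH K. apply succ_spec in K as [K| <-].
      + specialize (IH K).
        assert (n <> j) by (intros ->; now apply not_in_self in K).
        specialize (HST n Hn H). destruct (classic (n ∈ S)) as [E|E].
        * rewrite !partial_succ_in by tauto. rewrite IH. apply (mul_assoc HG); auto.
        * rewrite !partial_succ_out by tauto. exact IH.
      + rewrite partial_succ_in, partial_succ_out, <- Eq by auto. symmetry. exact Ew. }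
  assert (Hlim : limit S = w ∗ limit T).
  { apply Pext; auto. intros k Hk. rewrite Pmul_app by auto.
    destruct (nat_upper j k Hj Hk) as [n [Hn [Hjn Hkn]]].
    rewrite <- !(partial_limit _ n k) by trivial.
    rewrite (Hpart n Hn Hjn). apply Pmul_app; auto. }
  (* [len_conj] with u = x and v = limit T bounds len (s j) by four lengths. Each of them, times
     eight, is at most len (s j): twice by [partial_len], then by [H1] and [H2]. *)
  apply (Hspos j Hj), (oct_le_quad R HR); [auto|].
  apply (le_trans R HR (oct R ((len x ⊕ len x) ⊕ (len (limit S) ⊕ len (limit T))))).
  - apply (oct_le R HR). rewrite Hlim. apply (len_conj HG HX Ha Ho); auto.
  - rewrite !(oct_add R HR) by auto.
    assert (Hxl : oct R (len x) ≤ len (app s j)) by exact (partial_len S j Hj).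
    exact (le_add R HR _ _ _ _ (le_add R HR _ _ _ _ Hxl Hxl) (le_add R HR _ _ _ _ H1 H2)).
Qed.

(** The set E of the overview is given by [par] as the positions of value [one], and O is the rest;
    a point of the Cantor space is read as an indicator function. *)
Definition even_part (par x : M) : M :=
  compr omega (fun k => app x k = one /\ app par k = one).
Definition odd_part (par x : M) : M :=
  compr omega (fun k => app x k = one /\ app par k <> one).

(** A parity function: two consecutive positions always lie in different halves, which makes both
    halves infinite. *)
Lemma alternating : exists par, (forall n, n ∈ omega -> app par n ∈ two) /\
  forall n, n ∈ omega -> app par n <> app par (succ n).
Proof.
  apply (dependent_choice HDC two (fun x y => x <> y)); [def| |].
  - exists zero. apply two_spec. now left.
  - pose proof zero_neq_one. intros x Hx. apply two_spec in Hx as [->| ->];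
    [exists one|exists zero]; rewrite two_spec; auto.
Qed.

(** * A subset of the Cantor space without the Baire property *)

Section Toggle.
Context (par : M) (Hpar : forall n, n ∈ omega -> app par n ∈ two)
  (Halt : forall n, n ∈ omega -> app par n <> app par (succ n)).

Notation C := (cantor omega).
Notation ev x := (len (limit (even_part par x))).
Notation od x := (len (limit (odd_part par x))).

Lemma even_spec x k : k ∈ even_part par x <-> k ∈ omega /\ app x k = one /\ app par k = one.
Proof. unfold even_part. now rewrite compr_spec by def. Qed.

Lemma odd_spec x k : k ∈ odd_part par x <-> k ∈ omega /\ app x k = one /\ app par k <> one.
Proof. unfold odd_part. now rewrite compr_spec by def. Qed.

(** The lengths are monotone, so [succ j] serves as well as [j], and by alternation one of the two
    lies in the half selected by [i]. *)
Lemma large_position (i : bool) b n : b ∈ ℝ -> n ∈ omega ->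
  exists j, j ∈ omega /\ n ∈ succ j /\ ~ len (app s j) ≤ b /\
    if i then app par j = one else app par j <> one.
Proof.
  intros Hb Hn. destruct (len_unbounded b n Hb Hn) as [j [Hj [Hnj H]]].
  assert (Hsj : ~ len (app s (succ j)) ≤ b).
  { intros K. apply H. apply (le_trans R HR _ _ _) with (2 := K). apply len_mono; auto. }
  assert (E : app par j = one /\ app par (succ j) <> one \/
              app par j <> one /\ app par (succ j) = one).
  { pose proof (Halt j Hj). pose proof (Hpar j Hj) as K.
    pose proof (Hpar _ (omega_succ j Hj)) as K'. apply two_spec in K, K'.
    pose proof zero_neq_one. intuition congruence. }
  assert (n ∈ succ (succ j)) by now apply in_succ_of.
  destruct i, E as [[E E']|[E E']]; [exists j|exists (succ j)|exists (succ j)|exists j]; auto.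
Qed.

(** [limit_toggle] made symmetric in [S] and [T]: two limits of length at most b would both be at
    most an eighth of len (s j). *)
Lemma toggle_large S T j b : j ∈ omega -> b ∈ ℝ -> (j ∈ S <-> ~ j ∈ T) ->
  (forall k, k ∈ omega -> k <> j -> (k ∈ S <-> k ∈ T)) ->
  ~ len (app s j) ≤ oct R b -> len (limit S) ≤ b -> ~ len (limit T) ≤ b.
Proof.
  intros Hj Hb HjST HST Hbig H1 H2.
  assert (K : oct R b ≤ len (app s j)) by (apply (not_le R HR); auto).
  apply (oct_le R HR) in H1, H2.
  apply (le_trans R HR _ _ _) with (2 := K) in H1, H2.
  destruct (classic (j ∈ S)) as [E|E].
  - apply (limit_toggle S T j); tauto.
  - apply (limit_toggle T S j); trivial; [tauto|].
    intros k Hk N. now rewrite HST.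
Qed.

Lemma flip_one_ne j x k : k ∈ omega -> k <> j ->
  (app (flip omega j x) k = one <-> app x k = one).
Proof. intros Hk N. now rewrite flip_app_ne. Qed.

Lemma flip_even j x : j ∈ omega -> x ∈ C -> app par j = one ->
  odd_part par (flip omega j x) = odd_part par x /\
  (j ∈ even_part par x <-> ~ j ∈ even_part par (flip omega j x)) /\
  forall k, k ∈ omega -> k <> j ->
    (k ∈ even_part par x <-> k ∈ even_part par (flip omega j x)).
Proof.
  intros Hj Hx E. split; [|split].
  - apply set_ext. intros k. rewrite !odd_spec.
    destruct (classic (k = j)) as [->|N]; [tauto|].
    split; intros [Hk H]; (split; [exact Hk|]);
    pose proof (flip_one_ne j x k Hk N); tauto.
  - rewrite !even_spec, flip_one by trivial. tauto.
  - intros k Hk N. rewrite !even_spec, flip_one_ne by trivial. tauto.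
Qed.

Lemma flip_odd j x : j ∈ omega -> x ∈ C -> app par j <> one ->
  even_part par (flip omega j x) = even_part par x /\
  (j ∈ odd_part par x <-> ~ j ∈ odd_part par (flip omega j x)) /\
  forall k, k ∈ omega -> k <> j ->
    (k ∈ odd_part par x <-> k ∈ odd_part par (flip omega j x)).
Proof.
  intros Hj Hx E. split; [|split].
  - apply set_ext. intros k. rewrite !even_spec.
    destruct (classic (k = j)) as [->|N]; [tauto|].
    split; intros [Hk H]; (split; [exact Hk|]);
    pose proof (flip_one_ne j x k Hk N); tauto.
  - rewrite !odd_spec, flip_one by trivial. tauto.
  - intros k Hk N. rewrite !odd_spec, flip_one_ne by trivial. tauto.
Qed.

(** A far digit of E leaves [od x] fixed. With len (s j) above 8·od x, the switched left side can no
    longer be at most [od x]. *)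
Lemma leave_le x n : x ∈ C -> n ∈ omega -> ev x ≤ od x ->
  exists j, j ∈ omega /\ n ∈ succ j /\ ~ ev (flip omega j x) ≤ od (flip omega j x).
Proof.
  intros Hx Hn H. destruct (large_position true (oct R (od x)) n) as [j [Hj [Hnj [K E]]]]; auto.
  exists j. repeat split; trivial.
  destruct (flip_even j x Hj Hx E) as [-> [E1 E2]].
  now apply (toggle_large (even_part par x) _ j); auto.
Qed.

(** The same with the halves exchanged: [ev x] is now the fixed side, and a digit of O lifts the
    right side above it. *)
Lemma enter_le x n : x ∈ C -> n ∈ omega -> ~ ev x ≤ od x ->
  exists j, j ∈ omega /\ n ∈ succ j /\ ev (flip omega j x) ≤ od (flip omega j x).
Proof.
  intros Hx Hn H. destruct (large_position false (oct R (ev x)) n) as [j [Hj [Hnj [K E]]]]; auto.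
  exists j. repeat split; trivial.
  destruct (flip_odd j x Hj Hx E) as [-> [E1 E2]].
  apply (not_le R HR); [auto|auto|].
  apply (toggle_large (odd_part par x) _ j); auto.
  apply (not_le R HR); [auto|auto|exact H].
Qed.

Lemma flip_off j n x : j ∈ n -> off omega n x (flip omega j x).
Proof.
  intros Hj k Hk Nk. rewrite flip_app_ne; trivial. now intros ->.
Qed.

(** On the finite modifications of a generic point, [Y] and the open set [U] coincide. One of these
    modifications lies in [Y], hence in [U] together with a whole cylinder; a switch beyond the
    length of that cylinder stays in [U] but leaves [Y]. *)
Lemma no_baire_property : BP omega -> False.
Proof.
  intros HBP.
  set (Y := compr C (fun x => ev x ≤ od x)).
  assert (HY : forall x, x ∈ Y <-> x ∈ C /\ ev x ≤ od x).
  { intros x. unfold Y, even_part, odd_part. now rewrite compr_spec by def. }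
  destruct (HBP C cantor_is_cantor Y) as [U [D [HU [HD Hmeager]]]].
  { intros x Hx. now apply HY in Hx. }
  destruct (meager_generic HDC D Hmeager) as [x [Hx Hgen]].
  assert (HYU : forall n y, n ∈ omega -> y ∈ C -> off omega n x y -> (y ∈ Y <-> y ∈ U)).
  { intros n y Hn Hy E. pose proof (Hgen n y Hn Hy E) as N. rewrite HD in N. tauto. }
  (* The modification in [Y] is [x] itself or, by [enter_le], the result of one flip. *)
  assert (Hin : exists n y, n ∈ omega /\ y ∈ C /\ off omega n x y /\ y ∈ U /\ ev y ≤ od y).
  { destruct (classic (ev x ≤ od x)) as [H|H].
    - assert (E : off omega emp x x) by (intros k _ _; reflexivity).
      exists emp, x. repeat split; trivial; [apply omega_emp|].
      apply (HYU emp x); trivial; [apply omega_emp|]. apply HY. split; assumption.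
    - destruct (enter_le x emp Hx omega_emp H) as [j [Hj [_ K]]].
      assert (E : off omega (succ j) x (flip omega j x)) by (apply flip_off; auto).
      pose proof (flip_in j x Hx).
      exists (succ j), (flip omega j x). repeat split; auto.
      apply (HYU (succ j)); auto. apply HY. split; assumption. }
  destruct Hin as [n [y [Hn [Hy [Exy [HyU Hle]]]]]].
  destruct (open_agree U y HU HyU) as [l [Hl HlU]].
  destruct (leave_le y l Hy Hl Hle) as [j [Hj [Hlj N]]].
  (* The flipped point is compared with [x], not with [y], so [k] must exceed both the earlier
     changes below [n] and the new digit [j]. *)
  destruct (nat_upper n j Hn Hj) as [k [Hk [Hnk Hjk]]].
  pose proof (flip_in j y Hy) as Hf. apply N, (HY (flip omega j y)).
  apply (HYU k (flip omega j y) Hk Hf).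
  - intros i Hi Ni. rewrite flip_app_ne; trivial; [|now intros ->].
    apply Exy; [exact Hi|]. intros Hin. apply Ni. now apply (nat_trans _ n).
  (* [Hlj] says l ≤ j, so the flip does not touch the first [l] digits. *)
  - apply HlU; [exact Hf|]. intros i Hi. symmetry. apply flip_app_ne.
    + now apply (omega_trans _ l).
    + intros ->. exact (not_in_self _ (nat_lt_le_trans _ _ _ Hj Hi Hlj)).
Qed.

End Toggle.
End Contradiction.
End Tails.

Theorem theorem4p8 (M : structure) (HZF : ZF M)
  (omega : M) (Homega : is_omega omega)
  (HDC : DC omega) (HBP : BP omega)
  (R : field_data M) (HR : complete_ordered_field R)
  (A L : M) (HA : fun_on A omega) (HL : fun_on L omega)
  (HAL : forall n a l : M, rel A n a -> rel L n l -> strongly_bounded R a l)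
  (P m : M) (HP : is_product_group omega A L P m) :
  strongly_bounded R P m.
Proof.
  assert (HSB : forall n, n ∈ omega -> strongly_bounded R (app A n) (app L n)).
  { intros n Hn. apply (HAL n); now apply rel_app with omega. }
  assert (HG : group P m)
    by exact (P_group HA HL (fun n Hn => proj1 (HSB n Hn)) HP).
  split; [exact HG|]. intros X d a HX Ha o Ho.
  apply (bounded_orbit_of_len HX Ha Ho). apply NNPP. intros Hunb.
  destruct (growing_sequence HA HL HSB HP X d a o HX Ha Ho Hunb HDC) as [s [Hs Hgrow]].
  destruct (alternating HDC) as [par [Hpar Halt]].
  apply (no_baire_property HA HL HSB HP X d a o HX Ha Ho HDC s) with (par := par);
  trivial; intros n Hn; now apply Hs.
Qed.
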